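(* Consider the convex quadratically constrained quadratic program (QCQP) described in the context. Assume that Slater's constraint qualification holds for the QCQP and that the QCQP has an optimal solution. At each iteration $k$ of the PC$^2$PM algorithm described in the context, let the step size $\rho^{k+1}$ be updated according to the adaptive step-size rule in the context. Then, with an arbitrary starting point $(\mathbf{x}^0,\mathbf{u}^0,\bm{\lambda}^0,\bm{\gamma}^0)\in\mathbb{R}^{n_1}\times\mathbb{R}^{n_2}\times\mathbb{R}^{m_1}\times\mathbb{R}^{m_2}$, the sequence $\{(\mathbf{x}^k,\mathbf{u}^k,\bm{\lambda}^k,\bm{\gamma}^k)\}$ generated by the PC$^2$PM algorithm converges (as a whole sequence) to a saddle point $(\mathbf{x}^*,\mathbf{u}^*,\bm{\lambda}^*,\bm{\gamma}^* )$ of the QCQP.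
   Context: **Problem.** The QCQP is $$\min_{\mathbf{x}\in\mathbb{X},\ \mathbf{u}\in\mathbb{R}^{n_2}}\ \tfrac12\mathbf{x}^TP_0\mathbf{x}+\mathbf{q}_0^T\mathbf{x}+\mathbf{c}_0^T\mathbf{u}+r_0$$ subject to $\tfrac12\mathbf{x}^TP_i\mathbf{x}+\mathbf{q}_i^T\mathbf{x}+\mathbf{c}_i^T\mathbf{u}+r_i\le 0$ for $i=1,\dots,m_1$ (multipliers $\lambda_i$) and $A\mathbf{x}+B\mathbf{u}=\mathbf{b}$ (multiplier $\bm{\gamma}$). Here $P_i\in\mathbb{R}^{n_1\times n_1}$ is symmetric positive semidefinite, $\mathbf{q}_i\in\mathbb{R}^{n_1}$, $\mathbf{c}_i\in\mathbb{R}^{n_2}$, $r_i\in\mathbb{R}$ for $i=0,1,\dots,m_1$; $A\in\mathbb{R}^{m_2\times n_1}$, $B\in\mathbb{R}^{m_2\times n_2}$, $\mathbf{b}\in\mathbb{R}^{m_2}$; and $\mathbb{X}=\prod_{j=1}^{n_1}\mathbb{X}_j$ with $\mathbb{X}_j=\{x_j\in\mathbb{R}: 0\le x_j\le\bar X_j\}$. At least one of $P_1,\dots,P_{m_1}$ is nonzero. Slater's constraint qualification: there is a point $(\mathbf{x},\mathbf{u})$ with $\mathbf{x}\in\mathbb{X}$ and $A\mathbf{x}+B\mathbf{u}=\mathbf{b}$ at which all $m_1$ inequality constraints hold strictly. **Lagrangian and saddle points.** $\mathcal{L}(\mathbf{x},\mathbf{u},\bm{\lambda},\bm{\gamma})=\tfrac12\mathbf{x}^TP_0\mathbf{x}+\mathbf{q}_0^T\mathbf{x}+\mathbf{c}_0^T\mathbf{u}+r_0+\sum_{i=1}^{m_1}\lambda_i(\tfrac12\mathbf{x}^TP_i\mathbf{x}+\mathbf{q}_i^T\mathbf{x}+\mathbf{c}_i^T\mathbf{u}+r_i)+\bm{\gamma}^T(A\mathbf{x}+B\mathbf{u}-\mathbf{b})$.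 With $\mathbb{R}_+=[0,\infty)$, a point $(\mathbf{x}^*,\mathbf{u}^*,\bm{\lambda}^*,\bm{\gamma}^* )\in\mathbb{X}\times\mathbb{R}^{n_2}\times\mathbb{R}_+^{m_1}\times\mathbb{R}^{m_2}$ is a saddle point of the QCQP if $\mathcal{L}(\mathbf{x}^*,\mathbf{u}^*,\bm{\lambda},\bm{\gamma})\le\mathcal{L}(\mathbf{x}^*,\mathbf{u}^*,\bm{\lambda}^*,\bm{\gamma}^* )\le\mathcal{L}(\mathbf{x},\mathbf{u},\bm{\lambda}^*,\bm{\gamma}^* )$ for all $\mathbf{x}\in\mathbb{X}$, $\mathbf{u}\in\mathbb{R}^{n_2}$, $\bm{\lambda}\in\mathbb{R}_+^{m_1}$, $\bm{\gamma}\in\mathbb{R}^{m_2}$. **PC$^2$PM algorithm.** $\Pi_{\mathbb{Z}}$ denotes projection onto the closed convex set $\mathbb{Z}$. Choose an arbitrary starting point $(\mathbf{x}^0,\mathbf{u}^0,\bm{\lambda}^0,\bm{\gamma}^0)$. Given $(\mathbf{x}^k,\mathbf{u}^k,\bm{\lambda}^k,\bm{\gamma}^k)$, update the step size $\rho=\rho^{k+1}$ by the rule below and compute in order: Predictors: - $\mu_i^{k+1}=\Pi_{\mathbb{R}_+}\big(\lambda_i^k+\rho[\tfrac12(\mathbf{x}^k)^TP_i\mathbf{x}^k+\mathbf{q}_i^T\mathbf{x}^k+\mathbf{c}_i^T\mathbf{u}^k+r_i]\big)$, $i=1,\dots,m_1$; $\ \bm{\nu}^{k+1}=\bm{\gamma}^k+\rho(A\mathbf{x}^k+B\mathbf{u}^k-\mathbf{b})$;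 - $\mathbf{y}^{k+1}=\Pi_{\mathbb{X}}\big(\mathbf{x}^k-\rho[P_0\mathbf{x}^k+\mathbf{q}_0+\sum_{i=1}^{m_1}\lambda_i^k(P_i\mathbf{x}^k+\mathbf{q}_i)+A^T\bm{\gamma}^k]\big)$; - $\mathbf{v}^{k+1}=\mathbf{u}^k-\rho[\mathbf{c}_0+\sum_{i=1}^{m_1}\lambda_i^k\mathbf{c}_i+B^T\bm{\gamma}^k]$. Correctors: - $\mathbf{x}^{k+1}=\Pi_{\mathbb{X}}\big(\mathbf{x}^k-\rho[P_0\mathbf{y}^{k+1}+\mathbf{q}_0+\sum_{i=1}^{m_1}\mu_i^{k+1}(P_i\mathbf{y}^{k+1}+\mathbf{q}_i)+A^T\bm{\nu}^{k+1}]\big)$; - $\mathbf{u}^{k+1}=\mathbf{u}^k-\rho[\mathbf{c}_0+\sum_{i=1}^{m_1}\mu_i^{k+1}\mathbf{c}_i+B^T\bm{\nu}^{k+1}]$; - $\lambda_i^{k+1}=\Pi_{\mathbb{R}_+}\big(\lambda_i^k+\rho[\tfrac12(\mathbf{y}^{k+1})^TP_i\mathbf{y}^{k+1}+\mathbf{q}_i^T\mathbf{y}^{k+1}+\mathbf{c}_i^T\mathbf{v}^{k+1}+r_i]\big)$, $i=1,\dots,m_1$; $\ \bm{\gamma}^{k+1}=\bm{\gamma}^k+\rho(A\mathbf{y}^{k+1}+B\mathbf{v}^{k+1}-\mathbf{b})$. The iteration is run for all $k\ge0$ (no termination test). **Adaptive step-size rule.** Fix a scalar $0\le\epsilon_0<1$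 and scalars $\epsilon_1,\dots,\epsilon_8>0$ with $\sum_{s=1}^8\epsilon_s\le1-\epsilon_0$, and a constant $M>0$ (any fixed, arbitrarily large scalar). $\|\cdot\|_F$ is the Frobenius norm. Let $P\in\mathbb{R}^{m_1n_1\times n_1}$ be the matrix obtained by stacking $P_1,\dots,P_{m_1}$ vertically, $Q\in\mathbb{R}^{m_1\times n_1}$ the matrix with rows $\mathbf{q}_1^T,\dots,\mathbf{q}_{m_1}^T$, and $C\in\mathbb{R}^{m_1\times n_2}$ the matrix with rows $\mathbf{c}_1^T,\dots,\mathbf{c}_{m_1}^T$. The rule is given by a function $\rho:\mathbb{X}\times\mathbb{R}^{n_2}\times\mathbb{R}_+^{m_1}\times\mathbb{R}^{m_2}\to(0,+\infty)$, with $\rho^{k+1}=\rho(\mathbf{x}^k,\mathbf{u}^k,\bm{\lambda}^k,\bm{\gamma}^k):=\min\{\rho_1,\dots,\rho_8\}$, where: 1. $\rho_1=\epsilon_1/\|P_0\|_F$ if $\|P_0\|_F\ne0$, and $\rho_1=\epsilon_1$ otherwise. 2. $\rho_2=\min_{1\le i\le m_1}\rho_{2i}$, where, with $a_i=|\tfrac12(\mathbf{x}^k)^TP_i\mathbf{x}^k+\mathbf{q}_i^T\mathbf{x}^k+\mathbf{c}_i^T\mathbf{u}^k+r_i|\ge0$, $b_i=\lambda_i^k\ge0$, and $c_i=\frac{\epsilon_2}{m_1\|P_i\|_F}$ if $\|P_i\|_F\neq0$, $c_i=\frac{\epsilon_2}{m_1}$ otherwise: $\rho_{2i}=\frac{-b_i+\sqrt{b_i^2+4a_ic_i}}{2a_i}$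 if $a_i>0$; $\rho_{2i}=c_i/b_i$ if $a_i=0,b_i>0$; $\rho_{2i}=M$ if $a_i=0,b_i=0$. 3. With $a=\|P_0\mathbf{x}^k+\mathbf{q}_0+\sum_{i=1}^{m_1}\lambda_i^k(P_i\mathbf{x}^k+\mathbf{q}_i)+A^T\bm{\gamma}^k\|_2$, $b=2\|\mathbf{x}^k\|_2$, $c=\frac{2\epsilon_3}{\|P\|_F}$: $\rho_3=\min\{2\epsilon_3,\frac{-b+\sqrt{b^2+4ac}}{2a}\}$ if $a>0$; $\rho_3=\min\{2\epsilon_3,c/b\}$ if $a=0,b>0$; $\rho_3=2\epsilon_3$ if $a=0,b=0$. 4. $\rho_4=\epsilon_4/\|Q\|_F$ if $\|Q\|_F\ne0$, and $\rho_4=\epsilon_4$ otherwise. 5. $\rho_5=\frac{\epsilon_5}{\|\mathbf{x}^k\|_2\|P\|_F}$ if $\|\mathbf{x}^k\|_2\ne0$, and $\rho_5=\epsilon_5$ otherwise. 6. $\rho_6=\epsilon_6/\|C\|_F$ if $\|C\|_F\ne0$, and $\rho_6=\epsilon_6$ otherwise. 7. $\rho_7=\epsilon_7/\|A\|_F$ if $\|A\|_F\ne0$, and $\rho_7=\epsilon_7$ otherwise. 8. $\rho_8=\epsilon_8/\|B\|_F$ if $\|B\|_F\ne0$, and $\rho_8=\epsilon_8$ otherwise. *)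

(* Defs.v *)
From mathcomp Require Import all_boot all_order all_algebra.
From mathcomp Require Import all_classical all_reals all_analysis.

Set Implicit Arguments.
Unset Strict Implicit.
Unset Printing Implicit Defensive.

Import Order.TTheory GRing.Theory Num.Theory.
Import numFieldNormedType.Exports.

Local Open Scope classical_set_scope.
Local Open Scope ring_scope.

(* The Frobenius norm; on column vectors it is the Euclidean norm.
   The library norm `|A| on matrices is the max norm, hence this definition. *)
Definition normF (R : realType) (m n : nat) (A : 'M[R]_(m, n)) : R :=
  Num.sqrt (\sum_i \sum_j A i j ^+ 2).

Definition dotv (R : realType) (n : nat) (a b : 'cV[R]_n) : R :=
  (a^T *m b) 0 0.

Definition psdmx (R : realType) (n : nat) (A : 'M[R]_n) : Prop :=
  A^T = A /\ forall x : 'cV[R]_n, 0 <= dotv x (A *m x).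

(* A nearest point of Z to x for the distance induced by nrm. It is the
   projection when a nearest point exists and is unique, as for a nonempty
   closed convex Z and the Euclidean norm; it is x when there is none. *)
Definition proj (R : realType) (V : zmodType) (nrm : V -> R) (Z : set V)
    (x : V) : V :=
  xget x [set p | Z p /\ forall z, Z z -> nrm (x - p) <= nrm (x - z)].

(* The minimum of a nonempty sequence. *)
Definition minseq (R : realType) (s : seq R) : R :=
  \big[Num.min/head 0 s]_(t <- s) t.

(* Index 0 is kept apart: P0, q0, c0, r0 are the data of the objective and
   P i, q i, c i, r i those of the inequality constraints. *)
Record qcqp (R : realType) (n1 n2 m1 m2 : nat) := QCQP {
  P0 : 'M[R]_n1;
  q0 : 'cV[R]_n1;
  c0 : 'cV[R]_n2;
  r0 : R;
  P : 'I_m1 -> 'M[R]_n1;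
  q : 'I_m1 -> 'cV[R]_n1;
  c : 'I_m1 -> 'cV[R]_n2;
  r : 'I_m1 -> R;
  A : 'M[R]_(m2, n1);
  B : 'M[R]_(m2, n2);
  b : 'cV[R]_m2;
  Xbar : 'I_n1 -> R
}.

Section QCQP.
Variables (R : realType) (n1 n2 m1 m2 : nat) (Q : qcqp R n1 n2 m1 m2).

Definition point : Type := 'cV[R]_n1 * 'cV[R]_n2 * 'cV[R]_m1 * 'cV[R]_m2.

Implicit Types (x : 'cV[R]_n1) (u : 'cV[R]_n2) (l : 'cV[R]_m1) (g : 'cV[R]_m2).

Definition box : set 'cV[R]_n1 := [set x | forall j, 0 <= x j 0 <= Xbar Q j].

Definition Rplus : set R := [set t | 0 <= t].

Definition orthant : set 'cV[R]_m1 := [set l | forall i, Rplus (l i 0)].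

Definition objective x u : R :=
  2^-1 * dotv x (P0 Q *m x) + dotv (q0 Q) x + dotv (c0 Q) u + r0 Q.

Definition constraint (i : 'I_m1) x u : R :=
  2^-1 * dotv x (P Q i *m x) + dotv (q Q i) x + dotv (c Q i) u + r Q i.

Definition residual x u : 'cV[R]_m2 := A Q *m x + B Q *m u - b Q.

Definition convex_qcqp : Prop :=
  [/\ psdmx (P0 Q), forall i, psdmx (P Q i) & exists i, P Q i != 0].

Definition slater : Prop :=
  exists x u, [/\ box x, A Q *m x + B Q *m u = b Q
                & forall i, constraint i x u < 0].

Definition feasible x u : Prop :=
  [/\ box x, forall i, constraint i x u <= 0 & A Q *m x + B Q *m u = b Q].

Definition optimal x u : Prop :=
  feasible x u /\
  forall x' u', feasible x' u' -> objective x u <= objective x' u'.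

Definition lagrangian x u l g : R :=
  objective x u + \sum_i l i 0 * constraint i x u + dotv g (residual x u).

Definition saddle_point (z : point) : Prop :=
  let: (xs, us, ls, gs) := z in
  [/\ box xs, orthant ls &
    forall x u l g, box x -> orthant l ->
      lagrangian xs us l g <= lagrangian xs us ls gs /\
      lagrangian xs us ls gs <= lagrangian x u ls gs].

(* The gradients of the Lagrangian in x and in u. *)
Definition grad_x x l g : 'cV[R]_n1 :=
  P0 Q *m x + q0 Q + \sum_i l i 0 *: (P Q i *m x + q Q i) + (A Q)^T *m g.

Definition grad_u l g : 'cV[R]_n2 :=
  c0 Q + \sum_i l i 0 *: c Q i + (B Q)^T *m g.

Definition projX : 'cV[R]_n1 -> 'cV[R]_n1 := proj (@normF R n1 1) box.

Definition projRplus : R -> R := proj Num.norm Rplus.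

Definition pc2pm_step (rho : R) (z : point) : point :=
  let: (x, u, l, g) := z in
  let mu := \col_i projRplus (l i 0 + rho * constraint i x u) in
  let nu := g + rho *: residual x u in
  let y := projX (x - rho *: grad_x x l g) in
  let v := u - rho *: grad_u l g in
  (projX (x - rho *: grad_x y mu nu),
   u - rho *: grad_u mu nu,
   \col_i projRplus (l i 0 + rho * constraint i y v),
   g + rho *: residual y v).

Definition stackP : 'M[R]_(\sum_(i < m1) n1, n1) := \mxcol_(i < m1) P Q i.
Definition rowsQ : 'M[R]_(m1, n1) := \matrix_(i < m1) (q Q i)^T.
Definition rowsC : 'M[R]_(m1, n2) := \matrix_(i < m1) (c Q i)^T.

Variables (eps : nat -> R) (M : R).

Definition step_const (e nrm : R) : R := if nrm != 0 then e / nrm else e.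

(* The last branch also takes the case a = 0, b < 0, which can only occur
   for a starting point with a negative multiplier. *)
Definition rho2i (i : 'I_m1) x u l : R :=
  let a := `|constraint i x u| in
  let b := l i 0 in
  let c := if normF (P Q i) != 0 then eps 2 / (m1%:R * normF (P Q i))
           else eps 2 / m1%:R in
  if 0 < a then (- b + Num.sqrt (b ^+ 2 + 4 * a * c)) / (2 * a)
  else if 0 < b then c / b
  else M.

Definition rho2 x u l : R := minseq [seq rho2i i x u l | i <- enum 'I_m1].

Definition rho3 x l g : R :=
  let a := normF (grad_x x l g) in
  let b := 2 * normF x in
  let c := 2 * eps 3 / normF stackP in
  if 0 < a then
    Num.min (2 * eps 3) ((- b + Num.sqrt (b ^+ 2 + 4 * a * c)) / (2 * a))
  else if 0 < b then Num.min (2 * eps 3) (c / b)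
  else 2 * eps 3.

Definition rho5 x : R :=
  if normF x != 0 then eps 5 / (normF x * normF stackP) else eps 5.

Definition step_size (z : point) : R :=
  let: (x, u, l, g) := z in
  minseq [:: step_const (eps 1) (normF (P0 Q));
             rho2 x u l;
             rho3 x l g;
             step_const (eps 4) (normF rowsQ);
             rho5 x;
             step_const (eps 6) (normF rowsC);
             step_const (eps 7) (normF (A Q));
             step_const (eps 8) (normF (B Q))].

Definition pc2pm (z0 : point) (k : nat) : point :=
  iter k (fun z => pc2pm_step (step_size z) z) z0.

End QCQP.

(* Main.v *)
Require Import Defs.
From mathcomp Require Import all_boot all_order all_algebra.
From mathcomp Require Import all_classical all_reals all_analysis.
From mathcomp Require Import ring lra.

(* The method is the extragradient method for the monotone field
   F = (grad_x L, grad_u L, - grad_lambda L, - grad_gamma L) on the convex set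
   X x R^n2 x R_+^m1 x R^m2, whose variational inequality characterizes the
   saddle points of L.  The step-size rule bounds the variation of F between an
   iterate z and its predictor zb so that, for every saddle point zs,
   |z+ - zs|^2 <= |z - zs|^2 - delta |z - zb|^2 with delta = min_s eps_s.
   Hence the iterates are bounded and |z - zb| tends to 0.  Along an ultrafilter
   the iterates converge and the step sizes stay away from 0, so the limit solves
   the variational inequality; being a saddle point, its distance to the iterates
   is nonincreasing, which gives convergence of the whole sequence.  A saddle
   point exists by Farkas' lemma applied to the linearized problem at an optimal
   solution. *)

Set Implicit Arguments.
Unset Strict Implicit.
Unset Printing Implicit Defensive.

Import Order.TTheory GRing.Theory Num.Theory.
Import numFieldNormedType.Exports.

Local Open Scope classical_set_scope.
Local Open Scope ring_scope.

(** * Euclidean and Frobenius norms *)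

(** The obstacle is that the field is quadratic: its variation between [z] and the predictor
    involves the multipliers and the primal points themselves, so no fixed step works everywhere.
    The weights can be arranged as the predicted multipliers [mu], the sum [x + y] and the point
    [x]. The first two depend on the step being chosen; bounding them by affine functions of [rho]
    gives the conditions a rho^2 + b rho <= c, and this is where the square roots of the rule come
    from. A state-dependent step might shrink to 0. Its lower bound is uniform only where
    constraints, multipliers, gradient and primal norm are bounded, and such a bound is available
    near a limit of the iterates. The steps themselves need not converge. In the existence proof
    only the quadratic constraints have to become strict: box bounds and equations are affine, so
    first-order feasibility is enough for them. An arbitrary starting point may violate the box or
    the signs of the multipliers, but one step lands in [domain], whatever its size; the analysis
    starts there. *)

Section Euclidean.
Variable R : realType.

Lemma dotvE n (a b : 'cV[R]_n) : dotv a b = \sum_i a i 0 * b i 0.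
Proof. by rewrite /dotv mxE; apply: eq_bigr => i _; rewrite mxE. Qed.

Lemma dotvC n (a b : 'cV[R]_n) : dotv a b = dotv b a.
Proof. by rewrite !dotvE; apply: eq_bigr => i _; rewrite mulrC. Qed.

Lemma dotvDl n (a b d : 'cV[R]_n) : dotv (a + b) d = dotv a d + dotv b d.
Proof. by rewrite /dotv linearD mulmxDl mxE. Qed.

Lemma dotvZl n k (a d : 'cV[R]_n) : dotv (k *: a) d = k * dotv a d.
Proof. by rewrite /dotv linearZ -scalemxAl mxE. Qed.

Lemma dotvNl n (a d : 'cV[R]_n) : dotv (- a) d = - dotv a d.
Proof. by rewrite -scaleN1r dotvZl mulN1r. Qed.

Lemma dotvDr n (a b d : 'cV[R]_n) : dotv d (a + b) = dotv d a + dotv d b.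
Proof. by rewrite dotvC dotvDl !(dotvC d). Qed.

Lemma dotvZr n k (a d : 'cV[R]_n) : dotv d (k *: a) = k * dotv d a.
Proof. by rewrite dotvC dotvZl (dotvC d). Qed.

Lemma dotvNr n (a d : 'cV[R]_n) : dotv d (- a) = - dotv d a.
Proof. by rewrite dotvC dotvNl (dotvC d). Qed.

Lemma dotv0l n (d : 'cV[R]_n) : dotv 0 d = 0.
Proof. by rewrite -(scale0r 0) dotvZl mul0r. Qed.

Lemma dotv_suml n (I : finType) (F : I -> 'cV[R]_n) d :
  dotv (\sum_i F i) d = \sum_i dotv (F i) d.
Proof. by elim/big_rec2: _ => [|i a b _ <-]; rewrite ?dotv0l ?dotvDl. Qed.

Definition dotv_lin := (dotvDl, dotvDr, dotvNl, dotvNr, dotvZl, dotvZr).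

Lemma dotv_mulmx m n (a : 'cV[R]_m) (M : 'M[R]_(m, n)) b :
  dotv a (M *m b) = dotv (M^T *m a) b.
Proof. by rewrite /dotv trmx_mul trmxK mulmxA. Qed.

Lemma dotv_ge0 n (a : 'cV[R]_n) : 0 <= dotv a a.
Proof. by rewrite dotvE sumr_ge0 // => i _; rewrite -expr2 sqr_ge0. Qed.

Lemma normF_ge0 m n (M : 'M[R]_(m, n)) : 0 <= normF M.
Proof. exact: sqrtr_ge0. Qed.

Lemma normF_sqr m n (M : 'M[R]_(m, n)) :
  normF M ^+ 2 = \sum_i \sum_j M i j ^+ 2.
Proof.
by rewrite sqr_sqrtr //; do 2 apply: sumr_ge0 => ? _; exact: sqr_ge0.
Qed.

Lemma normF_cV n (a : 'cV[R]_n) : normF a ^+ 2 = dotv a a.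
Proof.
by rewrite normF_sqr dotvE; apply: eq_bigr => i _; rewrite big_ord1 expr2.
Qed.

Lemma normF_eq0 m n (M : 'M[R]_(m, n)) : (normF M == 0) = (M == 0).
Proof.
apply/eqP/eqP => [M0|->]; last first.
  by rewrite /normF !big1 ?sqrtr0 // => i _; rewrite big1 // => j _;
    rewrite mxE expr0n.
apply/matrixP => i j; rewrite mxE; apply/eqP; rewrite -sqrf_eq0; apply/eqP.
have := normF_sqr M; rewrite M0 expr0n => /esym/eqP.
rewrite psumr_eq0 => [/allP/(_ i)|k _]; last first.
  by apply: sumr_ge0 => ? _; exact: sqr_ge0.
rewrite mem_index_enum => /(_ isT) /eqP /eqP.
rewrite psumr_eq0 => [/allP/(_ j)|k _]; last exact: sqr_ge0.
by rewrite mem_index_enum => /(_ isT) /eqP.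
Qed.

(** The sum of the squares (d f_i - e g_i)^2 equals d (a d - e^2), so its sign settles the case d >
    0; if d = 0 then g vanishes and both sides are 0. *)
Lemma sum_CauchySchwarz (I : finType) (f g : I -> R) :
  `|\sum_i f i * g i|
    <= Num.sqrt (\sum_i f i ^+ 2) * Num.sqrt (\sum_i g i ^+ 2).
Proof.
set a := \sum_i f i ^+ 2; set d := \sum_i g i ^+ 2; set e := \sum_i _.
have a0 : 0 <= a by apply: sumr_ge0 => i _; exact: sqr_ge0.
have d0 : 0 <= d by apply: sumr_ge0 => i _; exact: sqr_ge0.
suff H : e ^+ 2 <= a * d by rewrite -sqrtrM // -sqrtr_sqr ler_wsqrtr.
have : 0 <= \sum_i (d * f i - e * g i) ^+ 2.
  by apply: sumr_ge0 => i _; exact: sqr_ge0.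
have E i : (d * f i - e * g i) ^+ 2 =
  d ^+ 2 * f i ^+ 2 + (- (2 * d * e)) * (f i * g i) + e ^+ 2 * g i ^+ 2 by ring.
rewrite (eq_bigr _ (fun i _ => E i)) !big_split /= -!mulr_sumr -/a -/d -/e => H.
move: d0; rewrite le_eqVlt => /predU1P[d0|d0]; last first.
  rewrite -subr_ge0 -(pmulr_rge0 _ d0); apply: le_trans H _.
  by rewrite le_eqVlt; apply/orP; left; apply/eqP; ring.
suff -> : e = 0 by rewrite expr0n -d0 mulr0.
apply: big1 => i _; suff -> : g i = 0 by rewrite mulr0.
apply/eqP; rewrite -sqrf_eq0; move/esym/eqP: d0.
rewrite psumr_eq0 => [/allP/(_ i)|k _]; last exact: sqr_ge0.
by rewrite mem_index_enum => /(_ isT).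
Qed.

(** Cauchy-Schwarz over pairs of indices, applied to [M] and the rank-one matrix a b^T, whose
    Frobenius norm is the product of the two norms. No operator norm is needed. *)
Lemma normF_bilinear m n (M : 'M[R]_(m, n)) a b :
  `|dotv a (M *m b)| <= normF M * normF a * normF b.
Proof.
have -> : dotv a (M *m b) = \sum_(p : 'I_m * 'I_n)
    M p.1 p.2 * (a p.1 0 * b p.2 0).
  rewrite -(pair_bigA _ (fun i j => M i j * (a i 0 * b j 0))) /= dotvE.
  by apply: eq_bigr => i _; rewrite mxE mulr_sumr; apply: eq_bigr => j _; ring.
apply: le_trans (sum_CauchySchwarz _ _) _.
rewrite -mulrA /normF -(pair_bigA _ (fun i j => M i j ^+ 2)) /=.
rewrite ler_wpM2l ?sqrtr_ge0 //.
rewrite -(pair_bigA _ (fun i j => (a i 0 * b j 0) ^+ 2)) /= -sqrtrM; last first.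
  by do 2 apply: sumr_ge0 => ? _; exact: sqr_ge0.
rewrite ler_wsqrtr // mulr_suml le_eqVlt; apply/orP; left; apply/eqP.
apply: eq_bigr => i _; rewrite mulr_sumr; apply: eq_bigr => j _.
by rewrite !big_ord1 exprMn.
Qed.

Lemma dotv_CauchySchwarz n (a b : 'cV[R]_n) :
  `|dotv a b| <= normF a * normF b.
Proof.
rewrite dotvE /normF; apply: le_trans (sum_CauchySchwarz _ _) _.
by rewrite le_eqVlt; apply/orP; left; apply/eqP;
  congr (Num.sqrt _ * Num.sqrt _); apply: eq_bigr => i _; rewrite big_ord1.
Qed.

Lemma normF_triangle n (a b : 'cV[R]_n) : normF (a + b) <= normF a + normF b.
Proof.
rewrite -(@ler_pXn2r _ 2) ?nnegrE ?addr_ge0 ?normF_ge0 //.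
rewrite sqrrD !normF_cV !dotv_lin (dotvC b a).
have := le_trans (ler_norm _) (dotv_CauchySchwarz a b); lra.
Qed.

Lemma normF_scale n k (a : 'cV[R]_n) : normF (k *: a) = `|k| * normF a.
Proof.
apply/eqP; rewrite -(@eqrXn2 _ 2) ?mulr_ge0 ?normF_ge0 //.
by rewrite exprMn !normF_cV !dotv_lin real_normK ?num_real //; apply/eqP; ring.
Qed.

Lemma normF_sub_eq0 n (a b : 'cV[R]_n) : normF (a - b) ^+ 2 <= 0 -> a = b.
Proof.
move=> H; apply/eqP; rewrite -subr_eq0 -normF_eq0 -sqrf_eq0.
by rewrite eq_le H sqr_ge0.
Qed.

Lemma big_tagnat n (p_ : 'I_n -> nat) (F : forall i, 'I_(p_ i) -> R) :
  \sum_k F (tagnat.sig1 k) (tagnat.sig2 k) = \sum_i \sum_j F i j.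
Proof.
rewrite (sig_big_dep _ _ F) (reindex (@tagnat.sig n p_)) //=.
exact: tagnat.sig_bij_on.
Qed.

(** The sum is a bilinear form of the stacked matrix, evaluated at [b] and at the Kronecker product
    [w] of [d] and [a], whose norm is the product of theirs. This is why the step-size rule uses the
    norm of the stack of the [P i]. *)
Lemma normF_trilinear p n (M : 'I_p -> 'M[R]_n) (d : 'cV[R]_p) a b :
  `|\sum_i d i 0 * dotv a (M i *m b)|
    <= normF (\mxcol_(i < p) M i) * normF d * normF a * normF b.
Proof.
pose w : 'cV[R]_(\sum_(i < p) n) :=
  \col_k (d (tagnat.sig1 k) 0 * a (tagnat.sig2 k) 0).
have -> : \sum_i d i 0 * dotv a (M i *m b) =
    dotv w ((\mxcol_(i < p) M i) *m b).
  transitivity (\sum_i \sum_j d i 0 * a j 0 * (M i *m b) j 0).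
    apply: eq_bigr => i _; rewrite dotvE mulr_sumr.
    by apply: eq_bigr => j _; rewrite mulrA.
  rewrite -(big_tagnat (fun i j => d i 0 * a j 0 * (M i *m b) j 0)) dotvE.
  apply: eq_bigr => k _; rewrite !mxE; congr (_ * _).
  by apply: eq_bigr => j _; rewrite mxE.
suff Ew : normF w = normF d * normF a.
  by apply: le_trans (normF_bilinear _ _ _) _; rewrite Ew mulrA.
apply/eqP; rewrite -(@eqrXn2 _ 2) ?mulr_ge0 ?normF_ge0 //; apply/eqP.
rewrite exprMn !normF_cV !dotvE.
under eq_bigr do rewrite mxE.
rewrite (big_tagnat (fun i j => d i 0 * a j 0 * (d i 0 * a j 0))) mulr_suml.
by apply: eq_bigr => i _; rewrite mulr_sumr; apply: eq_bigr => j _; ring.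
Qed.
End Euclidean.

(** * Farkas' lemma and existence of saddle points *)

Section Farkas.
Variables (R : realType) (V : lmodType R).

Definition linform (f : V -> R) : Prop :=
  forall k x y, f (k *: x + y) = k * f x + f y.

Lemma linform0 f : linform f -> f 0 = 0.
Proof. by move=> /(_ 1 0 0); rewrite scaler0 addr0 mul1r; lra. Qed.

Lemma linformZ f k x : linform f -> f (k *: x) = k * f x.
Proof. by move=> fl; rewrite -[k *: x]addr0 fl linform0 // addr0. Qed.

(** Induction on the number of inequalities. Either [i0] is redundant and gets multiplier 0, or some
    vector satisfies all the others with [f] positive. Rescaled to [e0], it splits the space into
    its own line and the kernel of [a i0], and the induction hypothesis is used along that
    kernel. *)
Lemma farkas (I : eqType) (s : seq I) (a : I -> V -> R) (f : V -> R) :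
    uniq s -> (forall i, linform (a i)) -> linform f ->
    (forall d, (forall i, i \in s -> a i d <= 0) -> f d <= 0) ->
  exists l : I -> R,
    (forall i, 0 <= l i) /\ forall d, f d = \sum_(i <- s) l i * a i d.
Proof.
elim: s a f => [|i0 s IH] a f /=.
  move=> _ _ fl f0; exists (fun=> 0); split=> // d; rewrite big_nil.
  have := f0 (- d); have := f0 d; rewrite -scaleN1r (linformZ _ _ fl).
  by move=> /(_ (fun=> ltac:(by []))) + /(_ (fun=> ltac:(by []))); lra.
case/andP=> i0s us al fl H.
have neq i : i \in s -> (i == i0) = false.
  by move=> si; apply: contraNF i0s => /eqP <-.
have [H'|] := pselect (forall d, (forall i, i \in s -> a i d <= 0) -> f d <= 0).
  have [l [l0 E]] := IH a f us al fl H'.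
  exists (fun i => if i == i0 then 0 else l i); split.
    by move=> i; case: ifP.
  move=> d; rewrite big_cons eqxx mul0r add0r E.
  by rewrite !big_seq; apply: eq_bigr => i si; rewrite neq.
move=> /existsNP[x0 /not_implyP[ax0 /negP]]; rewrite -ltNge => fx0.
have ai0 : 0 < a i0 x0.
  rewrite ltNge; apply/negP => ai0; move: fx0; rewrite ltNge => /negP; apply.
  by apply: H => i; rewrite inE => /predU1P[->|/ax0].
pose e0 := (a i0 x0)^-1 *: x0.
have e1 : a i0 e0 = 1 by rewrite linformZ // mulVf // gt_eqF.
have fe0 : 0 < f e0 by rewrite linformZ // mulr_gt0 // invr_gt0.
have ae0 i : i \in s -> a i e0 <= 0.
  by move=> si; rewrite linformZ // pmulr_rle0 ?invr_gt0 // ax0.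
have lin' g : linform g -> linform (fun d => g d - a i0 d * g e0).
  by move=> gl k x y; rewrite gl al; ring.
(* The modified forms are the old ones composed with the projection d - a_i0(d) e0 onto the kernel
   of [a i0], where the inequality [i0] holds trivially. *)
have [d ad|l [l0 E]] := IH (fun i d => a i d - a i0 d * a i e0)
    (fun d => f d - a i0 d * f e0) us (fun i => lin' _ (al i)) (lin' _ fl).
  have -> : f d - a i0 d * f e0 = f (- a i0 d *: e0 + d) by rewrite fl; ring.
  apply: H => i; rewrite inE al => /predU1P[->|si]; first by rewrite e1; lra.
  by have := ad _ si; lra.
(* The multiplier of [i0] is read off at [e0]; it is nonnegative since [f e0] is positive and every
   other form is nonpositive there. *)
exists (fun i => if i == i0 then f e0 - \sum_(i <- s) l i * a i e0 else l i).
split=> [i|d].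
  case: ifP => // _; rewrite subr_ge0; apply: le_trans (ltW fe0).
  rewrite big_seq; apply: sumr_le0 => j js.
  by rewrite mulr_ge0_le0 // ae0.
rewrite big_cons eqxx.
have -> : \sum_(j <- s) (if j == i0 then f e0 - \sum_(i <- s) l i * a i e0
    else l j) * a j d = \sum_(j <- s) l j * a j d.
  by rewrite !big_seq; apply: eq_bigr => i si; rewrite neq.
have := E d; under eq_bigr => i _ do rewrite mulrBr mulrCA.
rewrite sumrB -mulr_sumr; lra.
Qed.

End Farkas.

(** * Saddle points: expansions of the Lagrangian, variational inequality, multipliers *)

Section Saddle.
Variables (R : realType) (n1 n2 m1 m2 : nat) (Q : qcqp R n1 n2 m1 m2).

Local Notation pt := ('cV[R]_n1 * 'cV[R]_n2 * 'cV[R]_m1 * 'cV[R]_m2)%type.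
Implicit Types (x : 'cV[R]_n1) (u : 'cV[R]_n2) (l : 'cV[R]_m1) (g : 'cV[R]_m2).
Implicit Types (z w : pt).

Definition dotp z w : R :=
  dotv z.1.1.1 w.1.1.1 + dotv z.1.1.2 w.1.1.2 + dotv z.1.2 w.1.2 +
  dotv z.2 w.2.

Definition domain : set pt := [set z | box Q z.1.1.1 /\ orthant z.1.2].

Definition field z : pt :=
  let: (x, u, l, g) := z in
  (grad_x Q x l g, grad_u Q l g, \col_i - constraint Q i x u, - residual Q x u).

Hypothesis Qconvex : convex_qcqp Q.

(** Taylor's formula is exact for a quadratic; the remainder is isolated because positive
    semidefiniteness gives it a sign. *)
Lemma quadratic_expand n (S : 'M[R]_n) (a x x' : 'cV[R]_n) : S^T = S ->
  2^-1 * dotv x' (S *m x') + dotv a x' = 2^-1 * dotv x (S *m x) + dotv a x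
    + dotv (S *m x + a) (x' - x) + 2^-1 * dotv (x' - x) (S *m (x' - x)).
Proof.
move=> Ssym; rewrite mulmxBr !dotv_lin.
have -> : dotv x (S *m x') = dotv (S *m x) x' by rewrite dotv_mulmx Ssym.
rewrite (dotvC x' (S *m x)) (dotvC x (S *m x)); lra.
Qed.

Lemma objective_expand x u x' u' : objective Q x' u' = objective Q x u
  + dotv (P0 Q *m x + q0 Q) (x' - x) + dotv (c0 Q) (u' - u)
  + 2^-1 * dotv (x' - x) (P0 Q *m (x' - x)).
Proof.
case: Qconvex => -[Psym _] _ _.
rewrite /objective (quadratic_expand _ x x' Psym) !dotv_lin; ring.
Qed.

Lemma constraint_expand i x u x' u' : constraint Q i x' u' = constraint Q i x u
  + dotv (P Q i *m x + q Q i) (x' - x) + dotv (c Q i) (u' - u)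
  + 2^-1 * dotv (x' - x) (P Q i *m (x' - x)).
Proof.
case: Qconvex => _ /(_ i)[Psym _] _.
rewrite /constraint (quadratic_expand _ x x' Psym) !dotv_lin; ring.
Qed.

Lemma residualB x u x' u' :
  residual Q x' u' = residual Q x u + (A Q *m (x' - x) + B Q *m (u' - u)).
Proof.
rewrite /residual !mulmxBr; apply/matrixP => i j; rewrite !mxE; ring.
Qed.

Lemma grad_xE x l g d : dotv (grad_x Q x l g) d = dotv (P0 Q *m x + q0 Q) d
  + \sum_i l i 0 * dotv (P Q i *m x + q Q i) d + dotv g (A Q *m d).
Proof.
rewrite /grad_x (dotvDl _ ((A Q)^T *m g)) dotvDl dotv_suml dotv_mulmx.
by congr (_ + _ + _); apply: eq_bigr => i _; rewrite dotvZl.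
Qed.

Lemma grad_uE l g d : dotv (grad_u Q l g) d = dotv (c0 Q) d
  + \sum_i l i 0 * dotv (c Q i) d + dotv g (B Q *m d).
Proof.
rewrite /grad_u (dotvDl _ ((B Q)^T *m g)) dotvDl dotv_suml dotv_mulmx.
by congr (_ + _ + _); apply: eq_bigr => i _; rewrite dotvZl.
Qed.

Lemma lagrangian_convex x u l g x' u' : orthant l ->
  lagrangian Q x u l g + dotv (grad_x Q x l g) (x' - x)
    + dotv (grad_u Q l g) (u' - u) <= lagrangian Q x' u' l g.
Proof.
move=> l0; rewrite /lagrangian grad_xE grad_uE.
rewrite (objective_expand x u x' u') (residualB x u x' u').
rewrite (eq_bigr _ (fun i _ => congr1 (fun t => l i 0 * t)
  (constraint_expand i x u x' u'))).
under [in leRHS]eq_bigr do rewrite 3!mulrDr.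
rewrite !big_split /= (dotvDr (residual Q x u)) (dotvDr (A Q *m _)).
case: Qconvex => -[_ /(_ (x' - x)) h0] hi _.
have : 0 <= \sum_i l i 0 * (2^-1 * dotv (x' - x) (P Q i *m (x' - x))).
  apply: sumr_ge0 => i _; rewrite mulr_ge0 //; first exact: l0.
  by rewrite mulr_ge0 // (hi i).2.
lra.
Qed.

Lemma lagrangian_affine x u l g l' g' :
  lagrangian Q x u l' g' = lagrangian Q x u l g
    - dotv (\col_i - constraint Q i x u) (l' - l)
    - dotv (- residual Q x u) (g' - g).
Proof.
have -> : dotv (\col_i - constraint Q i x u) (l' - l) =
    \sum_i l i 0 * constraint Q i x u - \sum_i l' i 0 * constraint Q i x u.
  by rewrite dotvE -sumrB; apply: eq_bigr => i _;
    rewrite mxE [(l' - l) _ _]mxE [(- l) _ _]mxE; ring.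
rewrite /lagrangian; move: (residual Q x u) => e.
by rewrite !dotv_lin (dotvC g) (dotvC g'); ring.
Qed.

(* Varying the primal and the dual components separately splits the variational
   inequality into the two halves of the saddle inequality. *)
Lemma variational_saddle z : domain z ->
  (forall w, domain w -> 0 <= dotp (field z) (w - z)) -> saddle_point Q z.
Proof.
case: z => [[[x u] l] g] [/= bx l0] H; split=> // x' u' l' g' bx' l0'; split.
  have := H (x, u, l', g') (conj bx l0').
  rewrite /dotp /= !subrr -!(dotvC 0) !dotv0l => H1.
  rewrite (lagrangian_affine x u l g l' g'); lra.
have := H (x', u', l, g) (conj bx' l0).
rewrite /dotp /= !subrr !(dotvC _ 0) !dotv0l => H1.
have := lagrangian_convex x u g x' u' l0; lra.
Qed.

(** Monotonicity tested against a saddle point. Convexity in (x, u) and affinity in (l, g) bound the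
    product below by L(x, u, ls, gs) - L(xs, us, l, g), and the two saddle inequalities place the
    value at [zs] between these two. *)
Lemma saddle_monotone z zs : saddle_point Q zs -> domain z ->
  0 <= dotp (field z) (z - zs).
Proof.
case: z zs => [[[x u] l] g] [[[xs us] ls] gs] [bxs ls0 H] [/= bx l0].
have [_] := H x u ls gs bx ls0; have [+ _] := H xs us l g bxs l0.
have := lagrangian_convex x u g xs us l0.
rewrite (lagrangian_affine x u l g ls gs) /dotp /=.
rewrite !dotvDr !dotvNr; lra.
Qed.

(** Every strict condition on a small step below has this shape. Stating it with [near] lets
    finitely many of them be met by one step. *)
Lemma near_quadratic_lt0 (p k r : R) : p < 0 ->
  \forall s \near 0^'+, p + s * k + s ^+ 2 * r < 0.
Proof.
move=> p0; have K0 : 0 < `|k| + `|r| + 1 by rewrite ltr_wpDl // addr_ge0.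
near=> s.
have s0 : 0 < s by near: s; exact: nbhs_right_gt.
have s1 : s < 1 by near: s; exact: nbhs_right_lt.
have : s * (`|k| + `|r| + 1) < - p.
  rewrite -ltr_pdivlMr //; near: s; apply: nbhs_right_lt.
  by rewrite divr_gt0 // oppr_gt0.
have : s * k <= s * `|k| by rewrite ler_pM2l // ler_norm.
have : s ^+ 2 * r <= s * `|r|.
  rewrite expr2 -mulrA ler_pM2l //; apply: le_trans (ler_norm _) _.
  by rewrite normrM gtr0_norm // ler_piMl // ltW.
lra.
Unshelve. all: by end_near. Qed.

(* A direction d that is first-order feasible and decreases the objective to
   first order becomes strictly feasible when tilted towards the Slater point:
   this contradicts optimality, so Farkas' lemma provides the multipliers. *)
Lemma saddle_point_exists : slater Q -> (exists x u, optimal Q x u) ->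
  exists z, saddle_point Q z.
Proof.
move=> [xh [uh [bh eqh conh]]] [xs [us [[bs cons eqs] opt]]].
have shift n (x y : 'cV[R]_n) : x + y - x = y by rewrite addrAC subrr add0r.
pose df (d : 'cV[R]_n1 * 'cV[R]_n2) : R :=
  dotv (P0 Q *m xs + q0 Q) d.1 + dotv (c0 Q) d.2.
pose dc i (d : 'cV[R]_n1 * 'cV[R]_n2) : R :=
  dotv (P Q i *m xs + q Q i) d.1 + dotv (c Q i) d.2.
(* The index type is fixed: an inactive constraint contributes the zero form, and each equation
   contributes two opposite inequalities. *)
pose a (i : ('I_m1 + ('I_n1 + 'I_n1)) + ('I_m2 + 'I_m2))
    (d : 'cV[R]_n1 * 'cV[R]_n2) : R :=
  match i with
  | inl (inl i) => if constraint Q i xs us == 0 then dc i d else 0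
  | inl (inr (inl j)) => if xs j 0 == 0 then - d.1 j 0 else 0
  | inl (inr (inr j)) => if xs j 0 == Xbar Q j then d.1 j 0 else 0
  | inr (inl k) => (A Q *m d.1 + B Q *m d.2) k 0
  | inr (inr k) => - (A Q *m d.1 + B Q *m d.2) k 0
  end.
have Alin (k : R) (d d' : 'cV[R]_n1 * 'cV[R]_n2) :
    A Q *m (k *: d + d').1 + B Q *m (k *: d + d').2 =
    k *: (A Q *m d.1 + B Q *m d.2) + (A Q *m d'.1 + B Q *m d'.2).
  by rewrite /= !mulmxDr -!scalemxAr scalerDr addrACA.
have dfl : linform df by move=> k d d'; rewrite /df /= !dotvDr !dotvZr; ring.
have dcl i : linform (dc i).
  by move=> k d d'; rewrite /dc /= !dotvDr !dotvZr; ring.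
have al i : linform (a i).
  move=> k d d'; case: i => [[i|[j|j]]|[j|j]] /=.
  - by case: ifP => _; rewrite ?dcl //; ring.
  - by case: ifP => _; rewrite ?mxE; ring.
  - by case: ifP => _; rewrite ?mxE; ring.
  - by rewrite (Alin k d d') mxE [X in X + _]mxE.
  - by rewrite (Alin k d d') mxE [X in - (X + _)]mxE; ring.
have nfl : linform (fun d => - df d) by move=> k d d'; rewrite dfl; ring.
have [d ad|L [L0 E]] := farkas (index_enum_uniq _) al nfl.
  rewrite oppr_le0 leNgt; apply/negP => dfd.
  pose h : 'cV[R]_n1 * 'cV[R]_n2 := (xh - xs, uh - us).
  (* The tilt [t] is small enough for the objective still to decrease to first order. *)
  have [t [t0 dft]] : exists t, 0 < t /\ df d + t * df h < 0.
    near (0 : R)^'+ => t; exists t; split; first by near: t; exact: nbhs_right_gt.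
    have : df d + t * df h + t ^+ 2 * 0 < 0.
      by near: t; exact: near_quadratic_lt0.
    by rewrite mulr0 addr0.
  pose e := t *: h + d.
  have dce i : constraint Q i xs us = 0 -> dc i e < 0.
    move=> ci0; have := ad (inl (inl i)) (mem_index_enum _).
    rewrite /= ci0 eqxx => dcd; rewrite dcl.
    (* By convexity the linearization lies below the constraint, which is negative at the Slater
       point. *)
    have : dc i h < 0.
      have := conh i; rewrite (constraint_expand i xs us xh uh) ci0 /dc /=.
      by case: Qconvex => _ /(_ i)[_ /(_ (xh - xs))] + _; lra.
    by rewrite -(pmulr_rlt0 _ t0); lra.
  have Ae0 : A Q *m e.1 + B Q *m e.2 = 0.
    rewrite Alin [X in _ + X](_ : _ = 0); last first.
      apply/matrixP => k j; rewrite ord1 [RHS]mxE; apply/eqP; rewrite eq_le.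
      have := ad (inr (inl k)) (mem_index_enum _).
      have := ad (inr (inr k)) (mem_index_enum _).
      by rewrite /= oppr_le0 => -> ->.
    rewrite addr0 /= !mulmxBr addrACA -opprD eqh eqs subrr scaler0 //.
  have [s [s0 ob co bo]] : exists s, [/\ 0 < s,
      objective Q (xs + s *: e.1) (us + s *: e.2) < objective Q xs us,
      forall i, constraint Q i (xs + s *: e.1) (us + s *: e.2) <= 0
      & box Q (xs + s *: e.1)].
    near (0 : R)^'+ => s; exists s.
    have s0 : 0 < s by near: s; exact: nbhs_right_gt.
    split=> //.
    - rewrite (objective_expand xs us) !shift.
      rewrite -scalemxAr !(dotvZl, dotvZr) -subr_lt0.
      have : df e + s * (2^-1 * dotv e.1 (P0 Q *m e.1)) + s ^+ 2 * 0 < 0.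
        by near: s; apply: near_quadratic_lt0; rewrite dfl; lra.
      by rewrite -(pmulr_rlt0 _ s0) /df; lra.
    - near: s; apply: filter_forall => i.
      have expand s : constraint Q i (xs + s *: e.1) (us + s *: e.2) =
          constraint Q i xs us + s * dc i e
          + s ^+ 2 * (2^-1 * dotv e.1 (P Q i *m e.1)).
        rewrite (constraint_expand i xs us) !shift.
        by rewrite -scalemxAr !(dotvZl, dotvZr) /dc; ring.
      have [ci0|ci0] := eqVneq (constraint Q i xs us) 0; near=> s; rewrite expand.
        have s0 : 0 < s by near: s; exact: nbhs_right_gt.
        have : dc i e + s * (2^-1 * dotv e.1 (P Q i *m e.1)) + s ^+ 2 * 0 < 0.
          by near: s; apply: near_quadratic_lt0; exact: dce.
        by rewrite ci0 -(pmulr_rlt0 _ s0); lra.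
      by apply: ltW; near: s; apply: near_quadratic_lt0; rewrite lt_neqAle ci0 cons.
    - near: s; apply: filter_forall => j.
      have /andP[bs0 bsX] := bs j; have /andP[bh0 bhX] := bh j.
      have ej : e.1 j 0 = t * (xh j 0 - xs j 0) + d.1 j 0 by rewrite !mxE.
      have xsj s : (xs + s *: e.1) j 0 = xs j 0 + s * e.1 j 0 by rewrite !mxE.
      suff [lo hi] : (\forall s \near 0^'+, 0 <= xs j 0 + s * e.1 j 0) /\
          (\forall s \near 0^'+, xs j 0 + s * e.1 j 0 <= Xbar Q j).
        by near=> s; rewrite xsj; apply/andP; split; near: s.
      split.
        (* At an active bound both [d] and the direction to the Slater point go inward, so every
           positive step is admissible; an inactive bound only asks for a small one. *)
        have [x0|x0] := eqVneq (xs j 0) 0; near=> s.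
          have s0 : 0 < s by near: s; exact: nbhs_right_gt.
          have := ad (inl (inr (inl j))) (mem_index_enum _).
          rewrite /= x0 eqxx oppr_le0 add0r ej x0 subr0 => dj.
          by rewrite mulr_ge0 ?addr_ge0 ?mulr_ge0 // ltW.
        have : - xs j 0 + s * (- e.1 j 0) + s ^+ 2 * 0 < 0.
          near: s; apply: near_quadratic_lt0.
          by rewrite oppr_lt0 lt_neqAle eq_sym x0.
        lra.
      have [xX|xX] := eqVneq (xs j 0) (Xbar Q j); near=> s.
        have s0 : 0 < s by near: s; exact: nbhs_right_gt.
        have := ad (inl (inr (inr j))) (mem_index_enum _).
        rewrite /= xX eqxx => dj.
        have : s * e.1 j 0 <= 0.
          rewrite pmulr_rle0 // ej.
          have : t * (xh j 0 - xs j 0) <= 0 by rewrite pmulr_rle0 // xX subr_le0.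
          lra.
        lra.
      have : (xs j 0 - Xbar Q j) + s * e.1 j 0 + s ^+ 2 * 0 < 0.
        near: s; apply: near_quadratic_lt0.
        by rewrite subr_lt0 lt_neqAle xX.
      lra.
  have : objective Q xs us <= objective Q (xs + s *: e.1) (us + s *: e.2).
    apply: opt; split=> //.
    rewrite !mulmxDr addrACA eqs -!scalemxAr -scalerDr Ae0 scaler0 addr0 //.
  by rewrite leNgt ob.
(* Inactive constraints get multiplier 0, which builds complementary slackness in. The two
   multipliers of an equation merge into one of free sign. *)
pose l : 'cV[R]_m1 :=
  \col_i if constraint Q i xs us == 0 then L (inl (inl i)) else 0.
pose g : 'cV[R]_m2 := \col_k (L (inr (inl k)) - L (inr (inr k))).
exists (xs, us, l, g); apply: variational_saddle.
  by split=> //= i; rewrite /Rplus /= mxE; case: ifP.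
move=> [[[x u] l'] g'] [/= bx l0'].
have res0 : residual Q xs us = 0 by rewrite /residual eqs subrr.
rewrite /dotp /= res0 oppr0 dotv0l addr0 grad_xE grad_uE.
have := E (x - xs, u - us); rewrite !big_sumType /=.
have -> : \sum_i L (inl (inl i)) *
    (if constraint Q i xs us == 0 then dc i (x - xs, u - us) else 0) =
    \sum_i l i 0 * dotv (P Q i *m xs + q Q i) (x - xs)
    + \sum_i l i 0 * dotv (c Q i) (u - us).
  rewrite -big_split; apply: eq_bigr => i _; rewrite [l i 0]mxE /dc /=.
  by case: ifP => _; ring.
(* The box multipliers do not enter the saddle point: as [x] ranges over the box, their terms have a
   known sign and are dropped. *)
have : \sum_j L (inl (inr (inl j))) *
    (if xs j 0 == 0 then - (x - xs) j 0 else 0) <= 0.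
  apply: sumr_le0 => j _; rewrite mulr_ge0_le0 //; case: ifP => // /eqP x0.
  by rewrite !mxE x0 subr0 oppr_le0; have /andP[] := bx j.
have : \sum_j L (inl (inr (inr j))) *
    (if xs j 0 == Xbar Q j then (x - xs) j 0 else 0) <= 0.
  apply: sumr_le0 => j _; rewrite mulr_ge0_le0 //; case: ifP => // /eqP x0.
  by rewrite !mxE x0 subr_le0; have /andP[] := bx j.
have -> : \sum_k L (inr (inl k)) * (A Q *m (x - xs) + B Q *m (u - us)) k 0 =
    dotv g (A Q *m (x - xs)) + dotv g (B Q *m (u - us))
    + \sum_k L (inr (inr k)) * (A Q *m (x - xs) + B Q *m (u - us)) k 0.
  rewrite -dotvDr dotvE -big_split; apply: eq_bigr => k _ /=.
  by rewrite [g k 0]mxE; ring.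
have -> : \sum_k L (inr (inr k)) * - (A Q *m (x - xs) + B Q *m (u - us)) k 0 =
    - \sum_k L (inr (inr k)) * (A Q *m (x - xs) + B Q *m (u - us)) k 0.
  by rewrite -sumrN; apply: eq_bigr => k _; ring.
have : 0 <= dotv (\col_i - constraint Q i xs us) (l' - l).
  rewrite dotvE; apply: sumr_ge0 => i _.
  rewrite mxE [(l' - l) _ _]mxE [(- l) _ _]mxE [l i 0]mxE.
  case: ifP => [/eqP->|_]; first by rewrite oppr0 mul0r.
  by rewrite subr0 mulr_ge0 ?oppr_ge0 //; exact: l0'.
rewrite /df /=; lra.
Unshelve. all: by end_near. Qed.

End Saddle.

(** * Projections and the extragradient inequality *)

Section Projection.
Variables (R : realType) (n1 n2 m1 m2 : nat) (Q : qcqp R n1 n2 m1 m2).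

Local Notation pt := ('cV[R]_n1 * 'cV[R]_n2 * 'cV[R]_m1 * 'cV[R]_m2)%type.
Implicit Types (z w : pt).

Lemma dotpC z w : dotp z w = dotp w z.
Proof. by rewrite /dotp !(dotvC z.1.1.1, dotvC z.1.1.2, dotvC z.1.2, dotvC z.2). Qed.

Lemma dotpDl z z' w : dotp (z + z') w = dotp z w + dotp z' w.
Proof. by rewrite /dotp /= !dotvDl; ring. Qed.

Lemma dotpNl z w : dotp (- z) w = - dotp z w.
Proof. by rewrite /dotp /= !dotvNl; ring. Qed.

Lemma dotpZl k z w : dotp (k *: z) w = k * dotp z w.
Proof. by rewrite /dotp /= !dotvZl; ring. Qed.

Lemma dotpDr z z' w : dotp w (z + z') = dotp w z + dotp w z'.
Proof. by rewrite dotpC dotpDl !(dotpC _ w). Qed.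

Lemma dotpNr z w : dotp w (- z) = - dotp w z.
Proof. by rewrite dotpC dotpNl (dotpC _ w). Qed.

Lemma dotp_ge0 z : 0 <= dotp z z.
Proof. by rewrite /dotp !addr_ge0 // dotv_ge0. Qed.

Hypothesis Qconvex : convex_qcqp Q.
Hypothesis Xbar_ge0 : forall j, 0 <= Xbar Q j.

(** [proj] chooses some nearest point, so existence and uniqueness must be supplied. Clipping each
    coordinate gives [k], which satisfies the inequality coordinatewise; then |x - p|^2 >= |x - k|^2
    + |p - k|^2 on the box identifies every nearest point with [k]. *)
Lemma projX_variational (x : 'cV[R]_n1) :
  box Q (projX Q x) /\
  forall y, box Q y -> dotv (x - projX Q x) (y - projX Q x) <= 0.
Proof.
pose k : 'cV[R]_n1 := \col_j Num.min (Num.max (x j 0) 0) (Xbar Q j).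
have bk : box Q k.
  move=> j; rewrite mxE le_min le_max lexx orbT Xbar_ge0 /=.
  by rewrite ge_min lexx orbT.
have kP y : box Q y -> dotv (x - k) (y - k) <= 0.
  move=> bw; rewrite dotvE; apply: sumr_le0 => j _.
  have /andP[w0 wX] := bw j; have X0 := Xbar_ge0 j; rewrite !mxE.
  have [x0|x0] := ltP (x j 0) 0.
    by have [X1|X1] := ltP 0 (Xbar Q j); nra.
  by have [X1|X1] := ltP (x j 0) (Xbar Q j); nra.
have near_sq y p : (normF (x - p) <= normF (x - y)) =
    (dotv (x - p) (x - p) <= dotv (x - y) (x - y)).
  by rewrite -!normF_cV ler_pXn2r // nnegrE normF_ge0.
have pk y : dotv (x - y) (x - y) =
    dotv (x - k) (x - k) - 2 * dotv (x - k) (y - k) + dotv (y - k) (y - k).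
  rewrite !dotv_lin !(dotvC x) !(dotvC y); ring.
suff -> : projX Q x = k by [].
have [] : box Q (projX Q x) /\
    forall y, box Q y -> normF (x - projX Q x) <= normF (x - y).
  apply: (@xgetI _ _ [set p | box Q p /\
    forall y, box Q y -> normF (x - p) <= normF (x - y)] k).
  split=> // y bw; rewrite near_sq (pk y).
  by have := kP _ bw; have := dotv_ge0 (y - k); lra.
move=> bp /(_ k bk); rewrite near_sq pk => H.
apply: normF_sub_eq0; rewrite normF_cV; have := kP _ bp; lra.
Qed.

Lemma projRplus_variational (t : R) :
  0 <= projRplus t /\
  forall y : R, 0 <= y -> (t - projRplus t) * (y - projRplus t) <= 0.
Proof.
have [] : 0 <= projRplus t /\
    forall y : R, 0 <= y -> `|t - projRplus t| <= `|t - y|.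
  apply: (@xgetI _ _ [set p | 0 <= p /\
    forall y : R, 0 <= y -> `|t - p| <= `|t - y|] (Num.max t 0)).
  split=> [|y w0]; first by rewrite le_max lexx orbT.
  have [t0|t0] := ltP t 0; last by rewrite subrr normr0.
  by rewrite !ltr0_norm; lra.
move: (projRplus t) => p p0 H; split=> // y w0.
have [t0|t0] := leP 0 t.
  have := H t t0; rewrite subrr normr0 normr_le0 => /eqP ->; lra.
have := H 0 (lexx _); rewrite !ltr0_norm; [|lra..] => pt; nra.
Qed.

Definition projZ w : pt :=
  (projX Q w.1.1.1, w.1.1.2, \col_i projRplus (w.1.2 i 0), w.2).

Lemma projZ_domain w : domain Q (projZ w).
Proof.
split=> /=; first exact: (projX_variational _).1.
by move=> i; rewrite mxE; exact: (projRplus_variational _).1.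
Qed.

Lemma projZ_variational w z : domain Q z ->
  dotp (w - projZ w) (z - projZ w) <= 0.
Proof.
case: z w => [[[x u] l] g] [[[x' u'] l'] g'] [/= bx l0].
rewrite /dotp /= !subrr !dotv0l !addr0.
have := (projX_variational x').2 _ bx.
have : dotv (l' - \col_i projRplus (l' i 0)) (l - \col_i projRplus (l' i 0)) <= 0.
  rewrite dotvE; apply: sumr_le0 => i _; rewrite !mxE.
  by apply: (projRplus_variational _).2; exact: l0.
lra.
Qed.

Definition predictor rho z : pt := projZ (z - rho *: field Q z).

(** The dual components of [field] carry a minus sign, so the ascent in the multipliers becomes a
    descent step and the whole update is one projected step. *)
Lemma pc2pm_stepE rho z :
  pc2pm_step Q rho z = projZ (z - rho *: field Q (predictor rho z)).
Proof.
case: z => [[[x u] l] g].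
rewrite /pc2pm_step /predictor /projZ /=.
have colE (a b : 'I_m1 -> R) : a =1 b -> \col_i a i = \col_i b i :> 'cV[R]_m1.
  by move=> ab; apply/matrixP => i j; rewrite !mxE.
have muE : \col_i projRplus (l i 0 + rho * constraint Q i x u) =
    \col_i projRplus ((l - rho *: \col_i - constraint Q i x u) i 0).
  by apply: colE => i; rewrite !mxE mulrN opprK.
rewrite muE !scalerN !opprK; congr (_, _, _, _).
by apply: colE => i; rewrite !mxE mulrN opprK.
Qed.

(** Three inequalities are added: the predictor projection tested at [zp], the corrector projection
    tested at [zs], and [saddle_monotone] at [zb]. The only term without a sign is the variation of
    the field, paired with [zp - zb]. *)
Lemma extragradient_descent rho z zs : 0 < rho -> saddle_point Q zs ->
  forall zb zp, zb = predictor rho z -> zp = pc2pm_step Q rho z ->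
  dotp (zp - zs) (zp - zs) <= dotp (z - zs) (z - zs)
    - dotp (z - zb) (z - zb) - dotp (zp - zb) (zp - zb)
    + 2 * rho * dotp (field Q z - field Q zb) (zp - zb).
Proof.
move=> rho0 zsP zb zp zbE; rewrite pc2pm_stepE -zbE => zpE.
have zsD : domain Q zs by case: zs zsP => [[[xs us] ls] gs] [bx l0 _].
have zpD : domain Q zp by rewrite zpE; exact: projZ_domain.
have zbD : domain Q zb by rewrite zbE; exact: projZ_domain.
have H1 := projZ_variational (z - rho *: field Q z) zpD.
have H2 := projZ_variational (z - rho *: field Q zb) zsD.
have H3 := saddle_monotone Qconvex zsP zbD.
move: H1 H2 H3; rewrite -/(predictor rho z) -zbE -zpE.
move: (field Q z) (field Q zb) => f fb.
have -> : dotp fb (zb - zs) = dotp fb (zb - zp) - dotp fb (zs - zp).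
  by rewrite !(dotpDr, dotpNr); ring.
have -> : dotp (z - rho *: fb - zp) (zs - zp) =
    dotp (z - zp) (zs - zp) - rho * dotp fb (zs - zp).
  by rewrite !(dotpDl, dotpNl, dotpZl); ring.
move=> H1 H2; rewrite -(pmulr_rge0 _ rho0) => H3.
have -> : dotp (zp - zs) (zp - zs) = dotp (z - zs) (z - zs)
    - dotp (z - zp) (z - zp) + 2 * dotp (z - zp) (zs - zp).
  by rewrite !(dotpDl, dotpDr, dotpNl, dotpNr) !(dotpC zs) !(dotpC zp); ring.
have -> : dotp (z - zp) (z - zp) = dotp (z - zb) (z - zb)
    + dotp (zp - zb) (zp - zb) - 2 * dotp (z - zb) (zp - zb).
  by rewrite !(dotpDl, dotpDr, dotpNl, dotpNr) !(dotpC zb) !(dotpC zp); ring.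
move: H1 H2 H3; rewrite !(dotpDl, dotpNl, dotpZl) !(dotpDr, dotpNr); lra.
Qed.
End Projection.

(** * Variation of the field *)

Section Lipschitz.
Variables (R : realType) (n1 n2 m1 m2 : nat) (Q : qcqp R n1 n2 m1 m2).
Local Notation pt := ('cV[R]_n1 * 'cV[R]_n2 * 'cV[R]_m1 * 'cV[R]_m2)%type.
Implicit Types (z zb zp : pt).
Hypothesis Qconvex : convex_qcqp Q.

(** Each term pairs one component of [z - zb] with one component of the test vector and matches one
    part of the step-size rule. The products l_i P_i x are split as mu_i P_i (x - y) + (l - mu)_i
    P_i x, and the quadratic constraints use the factorization (x + y)^T P_i (x - y). *)
Lemma field_bilinear x u l g y v mu nu x' u' l' g' :
  dotp (field Q (x, u, l, g) - field Q (y, v, mu, nu)) (x', u', l', g') =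
    dotv x' (P0 Q *m (x - y)) + \sum_i mu i 0 * dotv x' (P Q i *m (x - y))
    + \sum_i (l - mu) i 0 * dotv x' (P Q i *m x)
    + dotv (l - mu) (rowsQ Q *m x') + dotv (l - mu) (rowsC Q *m u')
    + dotv (g - nu) (A Q *m x') + dotv (g - nu) (B Q *m u')
    - 2^-1 * \sum_i l' i 0 * dotv (x + y) (P Q i *m (x - y))
    - dotv l' (rowsQ Q *m (x - y)) - dotv l' (rowsC Q *m (u - v))
    - dotv g' (A Q *m (x - y)) - dotv g' (B Q *m (u - v)).
Proof.
have rowsQE (a : 'cV[R]_m1) d :
    dotv a (rowsQ Q *m d) = \sum_i a i 0 * dotv (q Q i) d.
  rewrite dotvE; apply: eq_bigr => i _; rewrite !dotvE mxE; congr (_ * _).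
  by apply: eq_bigr => j _; rewrite !mxE.
have rowsCE (a : 'cV[R]_m1) d :
    dotv a (rowsC Q *m d) = \sum_i a i 0 * dotv (c Q i) d.
  rewrite dotvE; apply: eq_bigr => i _; rewrite !dotvE mxE; congr (_ * _).
  by apply: eq_bigr => j _; rewrite !mxE.
have vE (a d : 'cV[R]_m1) i : (a - d) i 0 = a i 0 - d i 0 by rewrite !mxE.
have colE (F : 'I_m1 -> R) i : (\col_i F i : 'cV[R]_m1) i 0 = F i by rewrite mxE.
rewrite /dotp /= (dotvDl (grad_x _ _ _ _)) (dotvDl (grad_u _ _ _)).
rewrite !dotvNl !grad_xE !grad_uE.
have -> : dotv (- residual Q x u - - residual Q y v) g' =
    - dotv g' (A Q *m (x - y)) - dotv g' (B Q *m (u - v)).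
  rewrite (residualB Q y v x u) opprK opprD addrAC addNr add0r dotvNl dotvC.
  by rewrite dotvDr; ring.
have -> : dotv (\col_i - constraint Q i x u - \col_i - constraint Q i y v) l' =
    - (2^-1 * \sum_i l' i 0 * dotv (x + y) (P Q i *m (x - y)))
    - dotv l' (rowsQ Q *m (x - y)) - dotv l' (rowsC Q *m (u - v)).
  rewrite rowsQE rowsCE mulr_sumr -!sumrN -!big_split dotvE.
  apply: eq_bigr => i _; rewrite vE !colE (constraint_expand Qconvex i y v x u).
  have -> : x + y = 2 *: y + (x - y).
    by apply/matrixP => k j; rewrite !mxE; ring.
  have -> : dotv (2 *: y + (x - y)) (P Q i *m (x - y)) =
     2 * dotv (P Q i *m y) (x - y) + dotv (x - y) (P Q i *m (x - y)).
    case: Qconvex => _ /(_ i)[Psym _] _.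
    by rewrite (dotvDl (2 *: y)) dotvZl dotv_mulmx Psym.
  by rewrite (dotvDl (P Q i *m y)) /=; field.
have -> : \sum_i l i 0 * dotv (P Q i *m x + q Q i) x' =
    \sum_i mu i 0 * dotv (P Q i *m y + q Q i) x'
    + \sum_i mu i 0 * dotv x' (P Q i *m (x - y))
    + \sum_i (l - mu) i 0 * dotv x' (P Q i *m x)
    + dotv (l - mu) (rowsQ Q *m x').
  rewrite rowsQE -!big_split; apply: eq_bigr => i _ /=.
  by rewrite vE mulmxBr !dotv_lin !(dotvC x'); ring.
have -> : \sum_i l i 0 * dotv (c Q i) u' =
    \sum_i mu i 0 * dotv (c Q i) u' + dotv (l - mu) (rowsC Q *m u').
  by rewrite rowsCE -big_split; apply: eq_bigr => i _ /=; rewrite vE; ring.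
have -> : dotv (P0 Q *m x + q0 Q) x' =
    dotv (P0 Q *m y + q0 Q) x' + dotv x' (P0 Q *m (x - y)).
  by rewrite mulmxBr !dotv_lin !(dotvC x'); ring.
rewrite !(dotvDl g) !dotvNl; lra.
Qed.

Lemma young_pm (e rho k a b t : R) : 0 <= e -> 0 <= rho -> 0 <= a -> 0 <= b ->
  `|t| <= k * a * b -> rho * k <= e ->
  2 * rho * t <= e * (a ^+ 2 + b ^+ 2) /\
  - (2 * rho * t) <= e * (a ^+ 2 + b ^+ 2).
Proof.
move=> e0 r0 a0 b0 tk rk.
have ab : 0 <= a * b by rewrite mulr_ge0.
have rt : rho * `|t| <= e * (a * b).
  apply: le_trans (ler_wpM2l r0 tk) _.
  have -> : rho * (k * a * b) = rho * k * (a * b) by ring.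
  by rewrite ler_wpM2r.
have : e * (2 * (a * b)) <= e * (a ^+ 2 + b ^+ 2).
  by rewrite ler_wpM2l // -subr_ge0; have := sqr_ge0 (a - b); lra.
have : rho * t <= rho * `|t| by rewrite ler_wpM2l // ler_norm.
have : rho * - t <= rho * `|t| by rewrite ler_wpM2l // -normrN ler_norm.
lra.
Qed.

(** Conjunct [s] is what part [s] of the rule must guarantee. The second and third involve the
    predictor [zb], hence the step itself. *)
Definition step_ok (e : nat -> R) (rho : R) z zb : Prop :=
  [/\ [/\ rho * normF (P0 Q) <= e 1%N,
      rho * (\sum_i zb.1.2 i 0 * normF (P Q i)) <= e 2%N,
      rho * (2^-1 * normF (stackP Q) * normF (z.1.1.1 + zb.1.1.1)) <= e 3%N
      & rho * normF (rowsQ Q) <= e 4%N],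
      rho * (normF (stackP Q) * normF z.1.1.1) <= e 5%N,
      rho * normF (rowsC Q) <= e 6%N,
      rho * normF (A Q) <= e 7%N
      & rho * normF (B Q) <= e 8%N].

(* No pair of components involves all eight bounds, so a margin delta is left
   even when they add up to 1. *)
Lemma field_lipschitz (e : nat -> R) (delta rho : R) z zb zp :
  0 <= rho -> orthant zb.1.2 ->
  (forall s, (1 <= s <= 8)%N -> delta <= e s) -> 0 <= delta ->
  \sum_(1 <= s < 9) e s <= 1 -> step_ok e rho z zb ->
  2 * rho * dotp (field Q z - field Q zb) (zp - zb) <=
    (1 - delta) * (dotp (z - zb) (z - zb) + dotp (zp - zb) (zp - zb)).
Proof.
move=> rho0; case: z zb zp => [[[x u] l] g] [[[y v] mu] nu] [[[x' u'] l'] g'].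
move=> /= mu0 de delta0.
have [d1 d2 d3 d4] := And4 (de 1%N isT) (de 2%N isT) (de 3%N isT) (de 4%N isT).
have [d5 d6 d7 d8] := And4 (de 5%N isT) (de 6%N isT) (de 7%N isT) (de 8%N isT).
(* Unfolding the big sum gives the explicit sum of eight terms that [lra] needs. *)
rewrite unlock /= addr0 => se [[/= h1 h2 h3 h4] /= h5 h6 h7 h8].
have -> : ((x', u', l', g') - (y, v, mu, nu) : pt) =
  (x' - y, u' - v, l' - mu, g' - nu) by [].
have -> : ((x, u, l, g) - (y, v, mu, nu) : pt) =
  (x - y, u - v, l - mu, g - nu) by [].
rewrite field_bilinear.
rewrite /dotp /= -!normF_cV.
move: (x' - y) (u' - v) (l' - mu) (g' - nu) (x - y) (u - v) (g - nu) (l - mu).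
move=> ex eu el eg dx du dg dl.
have e0 s : (1 <= s <= 8)%N -> 0 <= e s by move=> /de; exact: le_trans.
have Y s k m n (a : 'cV[R]_m) (d : 'cV[R]_n) t : (1 <= s <= 8)%N ->
    rho * k <= e s -> `|t| <= k * normF a * normF d ->
    2 * rho * t <= e s * (normF a ^+ 2 + normF d ^+ 2) /\
    - (2 * rho * t) <= e s * (normF a ^+ 2 + normF d ^+ 2).
  by move=> /e0 es ks ts; apply: young_pm ks; rewrite ?normF_ge0.
have [T1 _] := Y 1%N _ _ _ _ _ _ isT h1 (normF_bilinear (P0 Q) ex dx).
have [T4 _] := Y 4%N _ _ _ _ _ _ isT h4 (normF_bilinear (rowsQ Q) dl ex).
have [T5 _] := Y 6%N _ _ _ _ _ _ isT h6 (normF_bilinear (rowsC Q) dl eu).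
have [T6 _] := Y 7%N _ _ _ _ _ _ isT h7 (normF_bilinear (A Q) dg ex).
have [T7 _] := Y 8%N _ _ _ _ _ _ isT h8 (normF_bilinear (B Q) dg eu).
have [_ T9] := Y 4%N _ _ _ _ _ _ isT h4 (normF_bilinear (rowsQ Q) el dx).
have [_ T10] := Y 6%N _ _ _ _ _ _ isT h6 (normF_bilinear (rowsC Q) el du).
have [_ T11] := Y 7%N _ _ _ _ _ _ isT h7 (normF_bilinear (A Q) eg dx).
have [_ T12] := Y 8%N _ _ _ _ _ _ isT h8 (normF_bilinear (B Q) eg du).
have [|T2 _] := Y 2%N _ _ _ ex dx (\sum_i mu i 0 * dotv ex (P Q i *m dx)) isT h2.
  apply: le_trans (ler_norm_sum _ _ _) _; rewrite !mulr_suml.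
  apply: ler_sum => i _; rewrite normrM ger0_norm; last exact: mu0.
  by rewrite -!mulrA ler_wpM2l ?mulrA ?normF_bilinear //; exact: mu0.
have [|T3 _] := Y 5%N _ _ _ dl ex (\sum_i dl i 0 * dotv ex (P Q i *m x)) isT h5.
  apply: le_trans (normF_trilinear _ _ _ _) _.
  by rewrite le_eqVlt; apply/orP; left; apply/eqP; rewrite /stackP; ring.
have [|_ T8] := Y 3%N _ _ _ el dx
    (2^-1 * \sum_i el i 0 * dotv (x + y) (P Q i *m dx)) isT h3.
  rewrite normrM ger0_norm // -!mulrA ler_wpM2l //.
  apply: le_trans (normF_trilinear _ _ _ _) _.
  by rewrite le_eqVlt; apply/orP; left; apply/eqP; rewrite /stackP; ring.
have sq m (a : 'cV[R]_m) k : k <= 1 - delta ->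
    k * normF a ^+ 2 <= (1 - delta) * normF a ^+ 2.
  by move=> ka; rewrite ler_wpM2r // sqr_ge0.
(* For each component, the coefficient collects the [e s] of the terms among [T1] to [T12] in which
   it occurs. *)
have Sdx := sq _ dx (e 1%N + e 2%N + e 3%N + e 4%N + e 7%N) ltac:(lra).
have Sdl := sq _ dl (e 4%N + e 5%N + e 6%N) ltac:(lra).
have Sdu := sq _ du (e 6%N + e 8%N) ltac:(lra).
have Sdg := sq _ dg (e 7%N + e 8%N) ltac:(lra).
have Sex := sq _ ex (e 1%N + e 2%N + e 4%N + e 5%N + e 7%N) ltac:(lra).
have Sel := sq _ el (e 3%N + e 4%N + e 6%N) ltac:(lra).
have Seu := sq _ eu (e 6%N + e 8%N) ltac:(lra).
have Seg := sq _ eg (e 7%N + e 8%N) ltac:(lra).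
clear - T1 T2 T3 T4 T5 T6 T7 T8 T9 T10 T11 T12 Sdx Sdl Sdu Sdg Sex Sel Seu Seg.
lra.
Qed.
End Lipschitz.

(** * Step sizes *)

Section StepSize.
Variable R : realType.

Lemma minseq_le (s : seq R) t : t \in s -> minseq s <= t.
Proof.
rewrite /minseq; move: (head 0 s) => h; elim: s => // a s IH.
rewrite inE big_cons ge_min => /predU1P[->|/IH ->]; by rewrite ?lexx ?orbT.
Qed.

Lemma minseq_mem (s : seq R) : s != [::] -> minseq s \in s.
Proof.
case: s => // a s _; rewrite /minseq /=.
suff : forall r, \big[Num.min/a]_(t <- r) t \in a :: r.
  by move=> /(_ (a :: s)); rewrite !inE orbA orbb.
elim=> [|b r IH]; first by rewrite big_nil mem_head.
rewrite big_cons; case: (leP b _) => _; first by rewrite !inE eqxx orbT.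
by move: IH; rewrite !inE => /orP[->|->]; rewrite ?orbT.
Qed.

(** The positive root of a t^2 + b t = c, with the linear case and a default [M]. It is the common
    form of parts 2 and 3 of the rule. *)
Definition quad_step (a b c M : R) : R :=
  if 0 < a then (- b + Num.sqrt (b ^+ 2 + 4 * a * c)) / (2 * a)
  else if 0 < b then c / b
  else M.

Lemma quad_step_root a b c M : 0 < a -> 0 < c ->
  0 < quad_step a b c M /\
  a * quad_step a b c M ^+ 2 + b * quad_step a b c M = c.
Proof.
move=> a0 c0; rewrite /quad_step a0.
have ac : 0 < a * c by rewrite mulr_gt0.
have D0 : b ^+ 2 < b ^+ 2 + 4 * a * c by lra.
have D1 : 0 <= b ^+ 2 + 4 * a * c by apply: le_trans (ltW D0); exact: sqr_ge0.
have := sqr_sqrtr D1; have := sqrtr_ge0 (b ^+ 2 + 4 * a * c).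
move: (Num.sqrt _) => s s0 s2; split.
  rewrite divr_gt0 ?mulr_gt0 // addrC subr_gt0.
  by rewrite ltNge; apply/negP => sb; nra.
have a1 : a != 0 by rewrite gt_eqF.
apply: (mulfI (_ : 4 * a != 0)); first by rewrite mulf_neq0 // pnatr_eq0.
have -> : 4 * a * (a * ((- b + s) / (2 * a)) ^+ 2 + b * ((- b + s) / (2 * a))) =
  s ^+ 2 - b ^+ 2 by field.
by rewrite s2; ring.
Qed.

Lemma quad_step_le a b c M rho : 0 <= a -> 0 <= b -> 0 < c -> 0 <= rho ->
  rho <= quad_step a b c M -> a * rho ^+ 2 + b * rho <= c.
Proof.
move=> a0 b0 c0 r0; have [a1|a1] := ltP 0 a.
  have [] := quad_step_root b M a1 c0; move: (quad_step _ _ _ _) => t t0 <- rt.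
  by rewrite lerD ?ler_wpM2l // ler_pXn2r // nnegrE // ltW.
have -> : a = 0 by apply/eqP; rewrite eq_le a0 a1.
rewrite mul0r add0r /quad_step ltxx; case: ifPn => [b1|].
  by rewrite ler_pdivlMr // mulrC.
rewrite -leNgt => b1 _; have -> : b = 0 by lra.
by rewrite mul0r ltW.
Qed.

(** If the root t is below 1, then c = a t^2 + b t <= 2 K t. The extra 1 keeps the denominator
    positive when K = 0. *)
Lemma quad_step_ge a b c M K : 0 <= a <= K -> 0 <= b <= K -> 0 < c ->
  Num.min M (Num.min 1 (c / (2 * K + 1))) <= quad_step a b c M.
Proof.
move=> /andP[a0 aK] /andP[b0 bK] c0.
have K0 : 0 < 2 * K + 1 by lra.
have [a1|a1] := ltP 0 a.
  have [] := quad_step_root b M a1 c0; move: (quad_step _ _ _ _) => t t0 E.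
  rewrite !ge_min; case: (leP 1 t) => t1; rewrite ?orbT //= orbC ler_pdivrMr //.
  suff -> : c <= t * (2 * K + 1) by [].
  have : a * t ^+ 2 <= K * t.
    by apply: ler_pM => //; rewrite ?sqr_ge0 // expr2 ger_pMl // ltW.
  have : b * t <= K * t by rewrite ler_wpM2r // ltW.
  by move: E; lra.
rewrite /quad_step ltNge a1 /=; case: ifPn => b1; last by rewrite ge_min lexx.
by rewrite !ge_min ler_pM2l // lef_pV2 ?posrE // (_ : b <= _) ?orbT //; lra.
Qed.

Lemma step_const_gt0 (e n : R) : 0 < e -> 0 <= n -> 0 < step_const e n.
Proof.
rewrite /step_const le_eqVlt => e0 /predU1P[<-|n0]; first by rewrite eqxx.
by rewrite gt_eqF // divr_gt0.
Qed.

Lemma step_const_le (e n rho : R) : 0 < e -> 0 <= n -> rho <= step_const e n ->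
  rho * n <= e.
Proof.
rewrite /step_const le_eqVlt => e0 /predU1P[<-|n0]; first by rewrite mulr0 => _; exact: ltW.
by rewrite gt_eqF // ler_pdivlMr.
Qed.

(** * The step-size rule at a point with nonnegative multipliers *)

Variables (n1 n2 m1 m2 : nat) (Q : qcqp R n1 n2 m1 m2).
Local Notation pt := ('cV[R]_n1 * 'cV[R]_n2 * 'cV[R]_m1 * 'cV[R]_m2)%type.
Implicit Types (z zb zp : pt).
Hypothesis Qconvex : convex_qcqp Q.
Hypothesis Xbar_ge0 : forall j, 0 <= Xbar Q j.
Variables (eps : nat -> R) (M : R).
Hypothesis eps_gt0 : forall s, (1 <= s <= 8)%N -> 0 < eps s.
Hypothesis M_gt0 : 0 < M.

Definition rho2_const i : R :=
  if normF (P Q i) != 0 then eps 2 / (m1%:R * normF (P Q i))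
  else eps 2 / m1%:R.

Lemma rho2iE i x u l : rho2i Q eps M i x u l =
  quad_step `|constraint Q i x u| (l i 0) (rho2_const i) M.
Proof. by []. Qed.

Lemma rho3E x l g : rho3 Q eps x l g = Num.min (2 * eps 3)
  (quad_step (normF (grad_x Q x l g)) (2 * normF x)
    (2 * eps 3 / normF (stackP Q)) (2 * eps 3)).
Proof.
by rewrite /rho3 /quad_step; case: ifP => // _; case: ifP => // _; rewrite minxx.
Qed.

Lemma m1_gt0 : 0 < m1%:R :> R.
Proof. by case: Qconvex => _ _ [i _]; rewrite ltr0n (leq_trans _ (ltn_ord i)). Qed.

Lemma rho2_const_gt0 i : 0 < rho2_const i.
Proof.
rewrite /rho2_const; case: ifPn => n0; rewrite divr_gt0 ?eps_gt0 ?m1_gt0 //.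
by rewrite mulr_gt0 ?m1_gt0 // lt_neqAle eq_sym n0 normF_ge0.
Qed.

Lemma rho2_const_le i : rho2_const i * normF (P Q i) <= eps 2 / m1%:R.
Proof.
rewrite /rho2_const; case: ifPn => n0.
  by rewrite invfM mulrA divfK.
move: n0; rewrite negbK => /eqP ->; rewrite mulr0 divr_ge0 // ltW //.
exact: eps_gt0.
Qed.

Lemma stackP_gt0 : 0 < normF (stackP Q).
Proof.
rewrite lt_neqAle normF_ge0 andbT eq_sym normF_eq0.
case: Qconvex => _ _ [i]; apply: contraNneq => S0.
rewrite -(mxcolK (fun i => P Q i) i) -/(stackP Q) S0.
by apply/eqP/matrixP => j k; rewrite !mxE.
Qed.

Lemma rho2_seq_neq0 x u l : [seq rho2i Q eps M i x u l | i <- enum 'I_m1] != [::].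
Proof.
by rewrite -size_eq0 size_map size_enum_ord -lt0n; have := m1_gt0; rewrite ltr0n.
Qed.

Lemma projRplus_le (s t : R) : 0 <= t -> s <= t -> projRplus s <= t.
Proof.
move=> t0 st; have [p0 /(_ t t0)] := projRplus_variational s.
move: (projRplus s) p0 => p p0 H; rewrite leNgt; apply/negP => tp; nra.
Qed.

(** The dependence of the predictor on [rho] is removed by mu_i <= l_i + rho |constraint_i| and |x +
    y| <= 2 |x| + rho |grad_x|. Multiplied by [rho], these are exactly the quadratics whose roots
    define parts 2 and 3. *)
Lemma step_size_ok z rho : domain Q z -> rho = step_size Q eps M z -> 0 <= rho ->
  step_ok Q eps rho z (predictor Q rho z).
Proof.
case: z => [[[x u] l] g] [/= bx l0] rhoE rho0.
have le s : s \in [:: step_const (eps 1) (normF (P0 Q));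
             rho2 Q eps M x u l; rho3 Q eps x l g;
             step_const (eps 4) (normF (rowsQ Q)); rho5 Q eps x;
             step_const (eps 6) (normF (rowsC Q));
             step_const (eps 7) (normF (A Q));
             step_const (eps 8) (normF (B Q))] -> rho <= s.
  by rewrite rhoE; exact: minseq_le.
have S0 := stackP_gt0; have e3 : 0 < eps 3 by exact: eps_gt0.
split; first split.
- by apply: step_const_le; rewrite ?eps_gt0 ?normF_ge0 ?le // !inE eqxx ?orbT.
- have -> : eps 2 = \sum_(i < m1) eps 2 / m1%:R.
    rewrite sumr_const card_ord -[RHS]mulr_natr mulfVK //.
    by rewrite gt_eqF // m1_gt0.
  rewrite mulr_sumr; apply: ler_sum => i _.
  rewrite /= [(\col__ _) _ _]mxE !mxE /= mulrN opprK.
  have ri : rho <= rho2i Q eps M i x u l.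
    apply: (le_trans (le (rho2 Q eps M x u l) _)); first by rewrite !inE eqxx orbT.
    by apply: minseq_le; apply: map_f; rewrite mem_enum.
  have H1 := quad_step_le (normr_ge0 (constraint Q i x u)) (l0 i)
    (rho2_const_gt0 i) rho0 ri.
  have H2 : projRplus (l i 0 + rho * constraint Q i x u) <=
      l i 0 + rho * `|constraint Q i x u|.
    have := l0 i; rewrite /Rplus /= => li0.
    by apply: projRplus_le; rewrite ?addr_ge0 ?mulr_ge0 // lerD2l ler_wpM2l // ler_norm.
  apply: le_trans (rho2_const_le i); rewrite mulrA ler_wpM2r ?normF_ge0 //.
  by apply: le_trans (ler_wpM2l rho0 H2) _; lra.
- rewrite /=; set G := grad_x Q x l g; set y := projX _ _.
  (* As [x] lies in the box, the projection inequality can be tested at [x] itself. *)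
  have xy : normF (y - x) <= rho * normF G.
    have [_ /(_ x bx)] := projX_variational Xbar_ge0 (x - rho *: G).
    rewrite -/y => H.
    have : normF (y - x) * normF (y - x) <= rho * normF G * normF (y - x).
      rewrite -expr2 normF_cV.
      have := dotv_CauchySchwarz G (y - x) => /ler_normlP[CS _].
      have := ler_wpM2l rho0 CS; move: H; rewrite !dotv_lin.
      by rewrite !(dotvC x) !(dotvC y); lra.
    have := normF_ge0 (y - x); rewrite le_eqVlt => /predU1P[<- _|n0].
      by rewrite mulr_ge0 ?normF_ge0.
    by rewrite ler_pM2r.
  have xy2 : normF (x + y) <= 2 * normF x + rho * normF G.
    have -> : x + y = 2 *: x + (y - x).
      by apply/matrixP => i j; rewrite !mxE; ring.
    apply: le_trans (normF_triangle _ _) _.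
    by rewrite normF_scale ger0_norm // lerD2l.
  have := le (rho3 Q eps x l g); rewrite !inE eqxx !orbT => /(_ isT).
  rewrite rho3E le_min => /andP[_ ri].
  have := quad_step_le (normF_ge0 _) _ _ rho0 ri.
  rewrite mulr_ge0 ?normF_ge0 // divr_gt0 ?mulr_gt0 // => /(_ isT isT).
  rewrite ler_pdivlMr // -/G => H.
  have : rho * (normF (stackP Q) * normF (x + y)) <=
      rho * (normF (stackP Q) * (2 * normF x + rho * normF G)).
    by rewrite ler_wpM2l // ler_wpM2l // ltW.
  by lra.
- by apply: step_const_le; rewrite ?eps_gt0 ?normF_ge0 ?le // !inE eqxx ?orbT.
- rewrite /= mulrC.
  have := le (rho5 Q eps x); rewrite !inE eqxx !orbT => /(_ isT).
  rewrite /rho5; case: ifPn => [n0|].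
    rewrite ler_pdivlMr; last by rewrite mulr_gt0 // lt_neqAle eq_sym n0 normF_ge0.
    by lra.
  by rewrite negbK => /eqP -> _; rewrite mulr0 mul0r ltW // eps_gt0.
- by apply: step_const_le; rewrite ?eps_gt0 ?normF_ge0 ?le // !inE eqxx ?orbT.
- by apply: step_const_le; rewrite ?eps_gt0 ?normF_ge0 ?le // !inE eqxx ?orbT.
- by apply: step_const_le; rewrite ?eps_gt0 ?normF_ge0 ?le // !inE eqxx ?orbT.
Qed.

Definition bounded_point K z : Prop :=
  [/\ forall i, `|constraint Q i z.1.1.1 z.1.1.2| <= K, forall i, z.1.2 i 0 <= K,
    normF (grad_x Q z.1.1.1 z.1.2 z.2) <= K & 2 * normF z.1.1.1 <= K].

(** Each of the eight parts is bounded below by a positive constant depending only on [K] and the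
    data. The lemma serves twice: for positivity at a single point and for a uniform bound along a
    limit. *)
Lemma step_size_ge K : 0 <= K -> exists2 kappa, 0 < kappa &
  forall z, orthant z.1.2 -> bounded_point K z -> kappa <= step_size Q eps M z.
Proof.
move=> K0; have S0 := stackP_gt0.
have e0 k : (1 <= k <= 8)%N -> 0 < eps k by exact: eps_gt0.
pose low c L := Num.min L (Num.min 1 (c / (2 * K + 1))).
have low0 c L : 0 < c -> 0 < L -> 0 < low c L.
  by move=> c0 L0; rewrite !lt_min L0 ltr01 divr_gt0 //; lra.
pose s2 := [seq low (rho2_const i) M | i <- enum 'I_m1].
have s20 : s2 != [::].
  by rewrite -size_eq0 size_map size_enum_ord -lt0n; have := m1_gt0; rewrite ltr0n.
pose k3 := Num.min (2 * eps 3) (low (2 * eps 3 / normF (stackP Q)) (2 * eps 3)).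
pose k5 := Num.min (eps 5) (eps 5 / (K * normF (stackP Q) + 1)).
pose s := [:: step_const (eps 1) (normF (P0 Q)); minseq s2; k3;
             step_const (eps 4) (normF (rowsQ Q)); k5;
             step_const (eps 6) (normF (rowsC Q));
             step_const (eps 7) (normF (A Q));
             step_const (eps 8) (normF (B Q))].
have s2_gt0 : 0 < minseq s2.
  have /mapP[i _ ->] := minseq_mem s20.
  by apply: low0 => //; exact: rho2_const_gt0.
have k3_gt0 : 0 < k3.
  have e3 := e0 3%N isT.
  by rewrite lt_min mulr_gt0 //= low0 // ?divr_gt0 ?mulr_gt0.
have KS : 0 < K * normF (stackP Q) + 1.
  by rewrite ltr_wpDl // mulr_ge0 // ltW.
have k5_gt0 : 0 < k5 by rewrite lt_min e0 //= divr_gt0 // e0.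
exists (minseq s).
  have := @minseq_mem s isT; rewrite !inE.
  by do 7 (case/orP; first by move=> /eqP ->; rewrite ?step_const_gt0 ?normF_ge0 ?e0);
    move=> /eqP ->; rewrite step_const_gt0 ?normF_ge0 ?e0.
move=> [[[x u] l] g] /= l0 [/= Kc Kl KG Kx].
have le t : t \in s -> minseq s <= t by exact: minseq_le.
set s' := [:: _; _; _; _; _; _; _; _].
have := @minseq_mem s' isT; rewrite !inE.
case/orP => [/eqP ->|]; first by rewrite le // !inE eqxx ?orbT.
case/orP => [/eqP ->|].
  apply: (le_trans (le (minseq s2) _)); first by rewrite !inE eqxx ?orbT.
  rewrite /rho2; have /mapP[i _ ->] := minseq_mem (rho2_seq_neq0 x u l).
  rewrite rho2iE; apply: le_trans (quad_step_ge _ _ _ (rho2_const_gt0 i)).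
  - by apply: minseq_le; apply: map_f; rewrite mem_enum.
  - by rewrite normr_ge0 Kc.
  - by rewrite Kl andbT; exact: l0.
case/orP => [/eqP ->|].
  apply: (le_trans (le k3 _)); first by rewrite !inE eqxx ?orbT.
  rewrite rho3E le_min ge_min lexx /= ge_min; apply/orP; right.
  apply: quad_step_ge; rewrite ?normF_ge0 ?KG ?Kx ?mulr_ge0 ?normF_ge0 //.
  by rewrite divr_gt0 ?mulr_gt0 // e0.
case/orP => [/eqP ->|]; first by rewrite le // !inE eqxx ?orbT.
case/orP => [/eqP ->|].
  apply: (le_trans (le k5 _)); first by rewrite !inE eqxx ?orbT.
  rewrite /rho5; case: ifPn => n0; last by rewrite ge_min lexx.
  rewrite ge_min; apply/orP; right.
  have x0 : 0 < normF x by rewrite lt_neqAle eq_sym n0 normF_ge0.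
  rewrite ler_pM2l ?e0 // lef_pV2 ?posrE ?mulr_gt0 //.
  have : normF x * normF (stackP Q) <= K * normF (stackP Q).
    by rewrite ler_wpM2r ?normF_ge0 //; lra.
  by lra.
case/orP => [/eqP ->|]; first by rewrite le // !inE eqxx ?orbT.
case/orP => [/eqP ->|]; first by rewrite le // !inE eqxx ?orbT.
by move=> /eqP ->; rewrite le // !inE eqxx ?orbT.
Qed.

End StepSize.

(** * Limits of points *)

Lemma ultra_fmap (T S : Type) (f : T -> S) (F : set_system T) :
  UltraFilter F -> UltraFilter (f @ F).
Proof.
move=> FU; split; first exact: fmap_proper_filter.
move=> G GF sFG; apply/seteqP; split => [A GA|]; last exact: sFG.
have [//|FnA] := in_ultra_setVsetC (f @^-1` A) FU.
have /filter_ex[? []//] : G (A `&` ~` A).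
by apply: filterI => //; apply: sFG.
Qed.

Section Limits.
Variable R : realType.

Lemma ultra_bounded_cvg (T : Type) (U : set_system T) (u : T -> R) (K : R) :
  UltraFilter U -> (forall k, `|u k| <= K) -> exists l : R, u k @[k --> U] --> l.
Proof.
move=> UU uK; have := @segment_compact R (- K) K.
rewrite compact_ultra => /(_ (u @ U) (ultra_fmap u UU)) [|l [_ ul]]; last by exists l.
rewrite /fmap /=; apply: filterE => k.
by rewrite /= in_itv /= -ler_norml.
Qed.

(** Entrywise convergence reduces all limits to real ones; the topology of matrices and products
    reappears only in [cvg_cV_cvg] and [cvg_pt_cvg]. *)
Definition cvg_cV (T : Type) (F : set_system T) n (x : T -> 'cV[R]_n)
    (xs : 'cV[R]_n) : Prop :=
  forall i, x k i 0 @[k --> F] --> xs i 0.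

Section Continuity.
Context {T : Type} {F : set_system T} {FF : Filter F}.

Lemma cvg_sum_fin (I : finType) (f : I -> T -> R) (l : I -> R) :
  (forall i, f i x @[x --> F] --> l i) ->
  \sum_i f i x @[x --> F] --> \sum_i l i.
Proof. by move=> fl; apply: cvg_big => [|i _ //]; exact: add_continuous. Qed.

Lemma cvg_cV_cst n (x : 'cV[R]_n) : cvg_cV F (fun=> x) x.
Proof. by move=> i; exact: cvg_cst. Qed.

Lemma cvg_cVD n (x y : T -> 'cV[R]_n) xs ys : cvg_cV F x xs -> cvg_cV F y ys ->
  cvg_cV F (fun k => x k + y k) (xs + ys).
Proof.
move=> xl yl i; rewrite mxE; under eq_fun do rewrite mxE.
exact: cvgD (xl i) (yl i).
Qed.

Lemma cvg_cVZ n (s : T -> R) (ss : R) (x : T -> 'cV[R]_n) xs :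
  s k @[k --> F] --> ss -> cvg_cV F x xs ->
  cvg_cV F (fun k => s k *: x k) (ss *: xs).
Proof.
move=> sl xl i; rewrite mxE; under eq_fun do rewrite mxE.
exact: cvgM sl (xl i).
Qed.

Lemma cvg_cVN n (x : T -> 'cV[R]_n) xs : cvg_cV F x xs ->
  cvg_cV F (fun k => - x k) (- xs).
Proof.
move=> xl i; rewrite mxE; under eq_fun do rewrite mxE.
exact: cvgN (xl i).
Qed.

Lemma cvg_cV_mulmx m n (S : 'M[R]_(m, n)) (x : T -> 'cV[R]_n) xs :
  cvg_cV F x xs -> cvg_cV F (fun k => S *m x k) (S *m xs).
Proof.
move=> xl i; rewrite mxE; under eq_fun do rewrite mxE.
by apply: cvg_sum_fin => j; apply: cvgM (xl j); exact: cvg_cst.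
Qed.

Lemma cvg_cV_sum (I : finType) n (x : I -> T -> 'cV[R]_n) xs :
  (forall i, cvg_cV F (x i) (xs i)) ->
  cvg_cV F (fun k => \sum_i x i k) (\sum_i xs i).
Proof.
move=> xl j; rewrite summxE; under eq_fun do rewrite summxE.
by apply: cvg_sum_fin => i; exact: xl.
Qed.

Lemma cvg_dotv n (x y : T -> 'cV[R]_n) xs ys : cvg_cV F x xs -> cvg_cV F y ys ->
  dotv (x k) (y k) @[k --> F] --> dotv xs ys.
Proof.
move=> xl yl; rewrite dotvE; under eq_fun do rewrite dotvE.
by apply: cvg_sum_fin => j; exact: cvgM (xl j) (yl j).
Qed.

Variables (n1 n2 m1 m2 : nat) (Q : qcqp R n1 n2 m1 m2).
Local Notation pt := ('cV[R]_n1 * 'cV[R]_n2 * 'cV[R]_m1 * 'cV[R]_m2)%type.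

Definition cvg_pt (F : set_system T) (z : T -> pt) (zs : pt) : Prop :=
  [/\ cvg_cV F (fun k => (z k).1.1.1) zs.1.1.1,
      cvg_cV F (fun k => (z k).1.1.2) zs.1.1.2,
      cvg_cV F (fun k => (z k).1.2) zs.1.2 & cvg_cV F (fun k => (z k).2) zs.2].

Lemma cvg_ptD (z w : T -> pt) zs ws : cvg_pt F z zs -> cvg_pt F w ws ->
  cvg_pt F (fun k => z k + w k) (zs + ws).
Proof. by move=> [? ? ? ?] [? ? ? ?]; split; exact: cvg_cVD. Qed.

Lemma cvg_ptN (z : T -> pt) zs : cvg_pt F z zs ->
  cvg_pt F (fun k => - z k) (- zs).
Proof. by move=> [? ? ? ?]; split; exact: cvg_cVN. Qed.

Lemma cvg_pt_cst (z : pt) : cvg_pt F (fun=> z) z.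
Proof. by split; exact: cvg_cV_cst. Qed.

Lemma cvg_dotp (z w : T -> pt) zs ws : cvg_pt F z zs -> cvg_pt F w ws ->
  dotp (z k) (w k) @[k --> F] --> dotp zs ws.
Proof.
by move=> [? ? ? ?] [? ? ? ?]; do 3 ?[apply: cvgD]; exact: cvg_dotv.
Qed.

Lemma cvg_constraint i (x : T -> 'cV[R]_n1) (u : T -> 'cV[R]_n2) xs us :
  cvg_cV F x xs -> cvg_cV F u us ->
  constraint Q i (x k) (u k) @[k --> F] --> constraint Q i xs us.
Proof.
move=> xl ul; apply: cvgD; last exact: cvg_cst.
apply: cvgD; last by apply: cvg_dotv => //; exact: cvg_cV_cst.
apply: cvgD; last by apply: cvg_dotv => //; exact: cvg_cV_cst.
apply: cvgM; first exact: cvg_cst.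
by apply: cvg_dotv => //; exact: cvg_cV_mulmx.
Qed.

Lemma cvg_field (z : T -> pt) zs : cvg_pt F z zs ->
  cvg_pt F (fun k => field Q (z k)) (field Q zs).
Proof.
have -> : (fun k => field Q (z k)) = (fun k =>
    (grad_x Q (z k).1.1.1 (z k).1.2 (z k).2, grad_u Q (z k).1.2 (z k).2,
     \col_i - constraint Q i (z k).1.1.1 (z k).1.1.2,
     - residual Q (z k).1.1.1 (z k).1.1.2)).
  by apply: funext => k; case: (z k) => [[[]]].
case: zs => [[[xs us] ls] gs] [/= xl ul ll gl]; split => /=.
- apply: cvg_cVD; last exact: cvg_cV_mulmx.
  apply: cvg_cVD.
    by apply: cvg_cVD; [exact: cvg_cV_mulmx|exact: cvg_cV_cst].
  apply: cvg_cV_sum => i; apply: cvg_cVZ => //.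
  by apply: cvg_cVD; [exact: cvg_cV_mulmx|exact: cvg_cV_cst].
- apply: cvg_cVD; last exact: cvg_cV_mulmx.
  apply: cvg_cVD; first exact: cvg_cV_cst.
  by apply: cvg_cV_sum => i; apply: cvg_cVZ => //; exact: cvg_cV_cst.
- move=> i; rewrite mxE; under eq_fun do rewrite mxE.
  by apply: cvgN; exact: cvg_constraint.
- apply: cvg_cVN; apply: cvg_cVD; last by apply: cvg_cVN; exact: cvg_cV_cst.
  by apply: cvg_cVD; exact: cvg_cV_mulmx.
Qed.

Lemma cV_sqr_le n (x : 'cV[R]_n) i : x i 0 ^+ 2 <= dotv x x.
Proof.
rewrite dotvE (bigD1 i) //= -expr2 lerDl sumr_ge0 // => j _.
by rewrite -expr2 sqr_ge0.
Qed.

Lemma cvg_pt_dotp0 (z : T -> pt) (zs : pt) :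
  dotp (z k - zs) (z k - zs) @[k --> F] --> 0 -> cvg_pt F z zs.
Proof.
move=> z0.
have cV n (x : T -> 'cV[R]_n) (xs : 'cV[R]_n) :
    (forall k, dotv (x k - xs) (x k - xs) <= dotp (z k - zs) (z k - zs)) ->
    cvg_cV F x xs.
  move=> xz i; apply/cvgrPdistC_lt => e e0.
  have e2 : 0 < e ^+ 2 by rewrite exprn_gt0.
  near=> k.
  have ze : dotp (z k - zs) (z k - zs) < e ^+ 2.
    by near: k; exact: cvgr_lt z0 _ e2.
  rewrite -(@ltr_pXn2r _ 2) ?nnegrE ?(ltW e0) //.
  rewrite real_normK ?num_real //; apply: le_lt_trans ze.
  apply: le_trans (xz k); apply: le_trans (cV_sqr_le _ i).
  by rewrite !mxE.
have dz k : dotp (z k - zs) (z k - zs) =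
  dotv ((z k).1.1.1 - zs.1.1.1) ((z k).1.1.1 - zs.1.1.1) +
  dotv ((z k).1.1.2 - zs.1.1.2) ((z k).1.1.2 - zs.1.1.2) +
  dotv ((z k).1.2 - zs.1.2) ((z k).1.2 - zs.1.2) +
  dotv ((z k).2 - zs.2) ((z k).2 - zs.2) by [].
have d0 n (x : 'cV[R]_n) := dotv_ge0 x.
split; apply: cV => k; rewrite dz.
- by have := d0 _ ((z k).1.1.2 - zs.1.1.2); have := d0 _ ((z k).1.2 - zs.1.2);
    have := d0 _ ((z k).2 - zs.2); lra.
- by have := d0 _ ((z k).1.1.1 - zs.1.1.1); have := d0 _ ((z k).1.2 - zs.1.2);
    have := d0 _ ((z k).2 - zs.2); lra.
- by have := d0 _ ((z k).1.1.2 - zs.1.1.2); have := d0 _ ((z k).1.1.1 - zs.1.1.1);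
    have := d0 _ ((z k).2 - zs.2); lra.
- by have := d0 _ ((z k).1.1.2 - zs.1.1.2); have := d0 _ ((z k).1.2 - zs.1.2);
    have := d0 _ ((z k).1.1.1 - zs.1.1.1); lra.
Unshelve. all: by end_near. Qed.

Lemma cvg_cV_cvg n (x : T -> 'cV[R]_n) xs : cvg_cV F x xs -> x @ F --> xs.
Proof.
move=> xl A [B BN BA].
have : \forall k \near F, forall p : 'I_n * 'I_1, B p.1 p.2 (x k p.1 p.2).
  apply: filter_forall => -[i j]; rewrite ord1 /=; apply: xl.
  by have := BN i 0.
by apply: filterS => k H; apply: BA => i j; exact: (H (i, j)).
Qed.

Lemma cvg_pt_cvg (z : T -> pt) zs : cvg_pt F z zs -> z @ F --> zs.
Proof.
have -> : z = (fun k => ((z k).1.1.1, (z k).1.1.2, (z k).1.2, (z k).2)).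
  by apply: funext => k; case: (z k) => [[[]]].
case: zs => [[[xs us] ls] gs] [/= xl ul ll gl].
exact: (cvg_pair (cvg_pair (cvg_pair (cvg_cV_cvg xl) (cvg_cV_cvg ul))
  (cvg_cV_cvg ll)) (cvg_cV_cvg gl)).
Qed.
End Continuity.

Lemma ultra_bounded_pt (T : Type) (U : set_system T) (n1 n2 m1 m2 : nat)
    (z : T -> 'cV[R]_n1 * 'cV[R]_n2 * 'cV[R]_m1 * 'cV[R]_m2) w K :
  UltraFilter U -> (forall k, dotp (z k - w) (z k - w) <= K) ->
  exists zs, cvg_pt U z zs.
Proof.
move=> UU zK.
have cV n (x : T -> 'cV[R]_n) (y : 'cV[R]_n) :
    (forall k, dotv (x k - y) (x k - y) <= K) -> exists xs, cvg_cV U x xs.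
  move=> xK; have /choice[l lP] : forall i, exists l : R, x k i 0 @[k --> U] --> l.
    (* A number whose square is at most [K] is at most [K + 1], which avoids a square root. *)
    move=> i; apply: (ultra_bounded_cvg (K := `|y i 0| + (K + 1))) => k.
    have -> : x k i 0 = y i 0 + (x k - y) i 0 by rewrite !mxE; ring.
    apply: le_trans (ler_normD _ _) _; rewrite lerD2l.
    have := le_trans (cV_sqr_le _ i) (xK k).
    rewrite -(real_normK (num_real ((x k - y) i 0))).
    by move: `|_| (normr_ge0 ((x k - y) i 0)) => t t0; nra.
  by exists (\col_i l i) => i; rewrite mxE.
have d0 n (x : 'cV[R]_n) := dotv_ge0 x.
have dz k : dotv ((z k).1.1.1 - w.1.1.1) ((z k).1.1.1 - w.1.1.1) +
  dotv ((z k).1.1.2 - w.1.1.2) ((z k).1.1.2 - w.1.1.2) +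
  dotv ((z k).1.2 - w.1.2) ((z k).1.2 - w.1.2) +
  dotv ((z k).2 - w.2) ((z k).2 - w.2) <= K := zK k.
have dk k := And4 (d0 _ ((z k).1.1.1 - w.1.1.1)) (d0 _ ((z k).1.1.2 - w.1.1.2))
  (d0 _ ((z k).1.2 - w.1.2)) (d0 _ ((z k).2 - w.2)).
have [xs xl] : exists xs, cvg_cV U (fun k => (z k).1.1.1) xs.
  by apply: (cV _ _ w.1.1.1) => k; have := dz k; have [] := dk k; lra.
have [us ul] : exists us, cvg_cV U (fun k => (z k).1.1.2) us.
  by apply: (cV _ _ w.1.1.2) => k; have := dz k; have [] := dk k; lra.
have [ls ll] : exists ls, cvg_cV U (fun k => (z k).1.2) ls.
  by apply: (cV _ _ w.1.2) => k; have := dz k; have [] := dk k; lra.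
have [gs gl] : exists gs, cvg_cV U (fun k => (z k).2) gs.
  by apply: (cV _ _ w.2) => k; have := dz k; have [] := dk k; lra.
by exists (xs, us, ls, gs).
Qed.
End Limits.

(** * Convergence *)

Section Convergence.
Variables (R : realType) (n1 n2 m1 m2 : nat) (Q : qcqp R n1 n2 m1 m2).
Variables (eps : nat -> R) (M : R).
Local Notation pt := ('cV[R]_n1 * 'cV[R]_n2 * 'cV[R]_m1 * 'cV[R]_m2)%type.
Implicit Types (z zs w : pt).
Hypothesis Qconvex : convex_qcqp Q.
Hypothesis Xbar_ge0 : forall j, 0 <= Xbar Q j.
Hypothesis eps_gt0 : forall s : nat, (1 <= s <= 8)%N -> 0 < eps s.
Hypothesis eps_sum : \sum_(1 <= s < 9) eps s <= 1.
Hypothesis M_gt0 : 0 < M.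

Local Notation rho := (step_size Q eps M).
Local Notation zpred z := (predictor Q (rho z) z).
Local Notation znext z := (pc2pm_step Q (rho z) z).
Local Notation dist2 z w := (dotp (z - w) (z - w)).

Lemma step_size_gt0 z : domain Q z -> 0 < rho z.
Proof.
move=> [_ l0].
pose K := \sum_i `|constraint Q i z.1.1.1 z.1.1.2| + \sum_i z.1.2 i 0
  + normF (grad_x Q z.1.1.1 z.1.2 z.2) + 2 * normF z.1.1.1.
have c0 : 0 <= \sum_i `|constraint Q i z.1.1.1 z.1.1.2| by exact: sumr_ge0.
have s0 : 0 <= \sum_i z.1.2 i 0 by apply: sumr_ge0 => i _; exact: l0.
have g0 := normF_ge0 (grad_x Q z.1.1.1 z.1.2 z.2).
have x0 := normF_ge0 z.1.1.1.
have [|kappa kappa0 H] := step_size_ge Qconvex eps_gt0 M_gt0 (K := K).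
  by rewrite /K; lra.
apply: (lt_le_trans kappa0); apply: H => //; split; try by rewrite /K; lra.
- move=> i; have : `|constraint Q i z.1.1.1 z.1.1.2| <=
      \sum_i `|constraint Q i z.1.1.1 z.1.1.2|.
    by rewrite [leRHS](bigD1 i) //= lerDl sumr_ge0.
  by rewrite /K; lra.
- move=> i; have : z.1.2 i 0 <= \sum_i z.1.2 i 0.
    by rewrite [leRHS](bigD1 i) //= lerDl sumr_ge0 // => j _; exact: l0.
  by rewrite /K; lra.
Qed.

Lemma next_domain z : domain Q (znext z).
Proof. by rewrite pc2pm_stepE; exact: projZ_domain. Qed.

Definition margin : R := minseq [seq eps s | s <- iota 1 8].

Lemma margin_gt0 : 0 < margin.
Proof.
have /mapP[s] := @minseq_mem _ [seq eps s | s <- iota 1 8] isT.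
by rewrite mem_iota /margin => s8 ->; exact: eps_gt0.
Qed.

(** The variation of the field absorbs all but a fraction [margin] of the two negative squares; the
    square of [znext z - zpred z] is then dropped. *)
Lemma next_descent z zs : domain Q z -> saddle_point Q zs ->
  dist2 (znext z) zs <= dist2 z zs - margin * dist2 z (zpred z).
Proof.
move=> zD zsS; have r0 := step_size_gt0 zD.
have mu0 : orthant (zpred z).1.2 by exact: (projZ_domain _ _).2.
have ok := step_size_ok Qconvex Xbar_ge0 eps_gt0 zD (erefl (rho z)) (ltW r0).
have mle s : (1 <= s <= 8)%N -> margin <= eps s.
  by move=> s8; apply: minseq_le; apply: map_f; rewrite mem_iota.
have L := field_lipschitz Qconvex (znext z) (ltW r0) mu0 mle (ltW margin_gt0)
  eps_sum ok.
have D := extragradient_descent Qconvex Xbar_ge0 r0 zsS (erefl (zpred z))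
  (erefl (znext z)).
have m0 := margin_gt0.
have : 0 <= margin * dist2 (znext z) (zpred z).
  by rewrite mulr_ge0 ?dotp_ge0 // ltW.
lra.
Qed.

Variable z : nat -> pt.
Hypothesis z_domain : forall k, domain Q (z k).
Hypothesis z_next : forall k, z k.+1 = znext (z k).

Lemma dist2_nonincreasing zs : saddle_point Q zs ->
  nonincreasing_seq (fun k => dist2 (z k) zs).
Proof.
move=> zsS; apply/nonincreasing_seqP => k; rewrite z_next.
have := next_descent (z_domain k) zsS.
have : 0 <= margin * dist2 (z k) (zpred (z k)).
  by rewrite mulr_ge0 ?dotp_ge0 // ltW // margin_gt0.
lra.
Qed.

(** The gap is at most a constant times the difference of consecutive distances to [zs], and these
    distances converge. *)
Lemma predictor_gap_cvg0 zs : saddle_point Q zs ->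
  dist2 (z k) (zpred (z k)) @[k --> \oo] --> 0.
Proof.
move=> zsS.
have cv : cvgn (fun k => dist2 (z k) zs).
  apply: nonincreasing_is_cvgn; first exact: dist2_nonincreasing.
  by exists 0 => _ [k _ <-]; exact: dotp_ge0.
have m0 := margin_gt0.
apply: (@squeeze_cvgr _ _ _ _ (fun=> 0) (fun k =>
    margin^-1 * (dist2 (z k) zs - dist2 (z k.+1) zs))).
- apply: nearW => k; rewrite dotp_ge0 /= mulrC ler_pdivlMr // mulrC z_next.
  have := next_descent (z_domain k) zsS; lra.
- exact: cvg_cst.
- rewrite -(mulr0 margin^-1); apply: cvgM; first exact: cvg_cst.
  rewrite -(subrr (limn (fun k => dist2 (z k) zs))); apply: cvgB => //.
  by have := cv; rewrite -(cvg_shiftS (fun k => dist2 (z k) zs)).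
Qed.

Lemma domain_closed (U : set_system nat) zs : ProperFilter U ->
  cvg_pt U z zs -> domain Q zs.
Proof.
move=> UF [xl _ ll _]; split.
  move=> j; apply/andP; split.
    apply: cvgr_to_ge (xl j) _; apply: nearW => k.
    by have [/(_ j)/andP[]] := z_domain k.
  apply: cvgr_to_le (xl j) _; apply: nearW => k.
  by have [/(_ j)/andP[]] := z_domain k.
move=> i; apply: cvgr_to_ge (ll i) _; apply: nearW => k.
by have [_ /(_ i)] := z_domain k.
Qed.

Lemma near_bounded_point (U : set_system nat) zs : ProperFilter U ->
  cvg_pt U z zs -> exists2 K, 0 <= K & \forall k \near U, bounded_point Q K (z k).
Proof.
move=> UF zl; have [xl ul ll gl] := zl; have [gxl _ _ _] := cvg_field Q zl.
have near_le (f : nat -> R) (l : R) : f k @[k --> U] --> l ->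
    \forall k \near U, f k <= l + 1.
  by move=> /cvgr_le; apply; rewrite ltrDl.
(* The bound comes from 2 t <= t^2 + 1, so that only the continuity of [dotv] is needed. *)
have near_normF n (x : nat -> 'cV[R]_n) (xs : 'cV[R]_n) : cvg_cV U x xs ->
    \forall k \near U, normF (x k) <= dotv xs xs + 2.
  move=> xlim; near=> k.
  have : dotv (x k) (x k) <= dotv xs xs + 1.
    by near: k; apply: near_le; exact: cvg_dotv.
  by rewrite -normF_cV; have := sqr_ge0 (normF (x k) - 1); have := normF_ge0 (x k); lra.
pose c i := `|constraint Q i zs.1.1.1 zs.1.1.2| + 1.
pose l i := `|zs.1.2 i 0| + 1.
have c0 i : 0 <= c i by rewrite addr_ge0.
have l0 i : 0 <= l i by rewrite addr_ge0.
pose G := (field Q zs).1.1.1.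
have sc0 : 0 <= \sum_i c i by exact: sumr_ge0.
have sl0 : 0 <= \sum_i l i by exact: sumr_ge0.
have G0 := dotv_ge0 G; have x0 := dotv_ge0 zs.1.1.1.
pose K := \sum_i c i + \sum_i l i + (dotv G G + 2) + 2 * (dotv zs.1.1.1 zs.1.1.1 + 2).
exists K; first by rewrite /K; lra.
near=> k; split.
- move=> i; apply: (@le_trans _ _ (c i)); last first.
    have : c i <= \sum_i c i by rewrite [leRHS](bigD1 i) //= lerDl sumr_ge0.
    by rewrite /K; lra.
  move: i; near: k; apply: filter_forall => i; apply: near_le.
  by apply: cvg_norm; exact: cvg_constraint.
- move=> i; apply: (@le_trans _ _ (l i)); last first.
    have : l i <= \sum_i l i by rewrite [leRHS](bigD1 i) //= lerDl sumr_ge0.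
    by rewrite /K; lra.
  apply: le_trans (ler_norm _) _.
  move: i; near: k; apply: filter_forall => i; apply: near_le.
  by apply: cvg_norm; exact: ll.
- have : normF (grad_x Q (z k).1.1.1 (z k).1.2 (z k).2) <= dotv G G + 2.
    near: k; have := near_normF _ _ _ gxl; apply: filterS => k.
    by case: (z k) => [[[]]].
  by rewrite /K; lra.
- have : normF (z k).1.1.1 <= dotv zs.1.1.1 zs.1.1.1 + 2.
    by near: k; exact: near_normF.
  by rewrite /K; lra.
Unshelve. all: by end_near. Qed.

Lemma limit_saddle (U : set_system nat) zs ws : ProperFilter U -> \oo `<=` U ->
  saddle_point Q ws -> cvg_pt U z zs -> saddle_point Q zs.
Proof.
move=> UF ooU wsS zl.
have zsD : domain Q zs by exact: domain_closed zl.
have gap0 : cvg_pt U (fun k => z k - zpred (z k)) 0.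
  apply: cvg_pt_dotp0; under eq_fun do rewrite subr0.
  by move=> A /(predictor_gap_cvg0 wsS); exact: ooU.
have pl : cvg_pt U (fun k => zpred (z k)) zs.
  have -> : (fun k => zpred (z k)) = (fun k => z k + - (z k - zpred (z k))).
    by apply: funext => k; rewrite opprB addrC subrK.
  suff : cvg_pt U (fun k => z k + - (z k - zpred (z k))) (zs + - 0).
    by rewrite oppr0 addr0.
  exact: cvg_ptD zl (cvg_ptN gap0).
apply: (variational_saddle Qconvex zsD) => w wD.
have [K K0 near_bd] := near_bounded_point UF zl.
have [kappa kappa0 rho_ge] := step_size_ge Qconvex eps_gt0 M_gt0 K0.
have tl : dotp (field Q (z k)) (zpred (z k) - w) @[k --> U] -->
    dotp (field Q zs) (zs - w).
  apply: cvg_dotp; first exact: cvg_field.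
  by apply: cvg_ptD => //; apply: cvg_ptN; exact: cvg_pt_cst.
have sl : dotp (z k - zpred (z k)) (zpred (z k) - w) @[k --> U] --> (0 : R).
  rewrite -[0](_ : dotp (0 : pt) (zs - w) = 0); last first.
    by rewrite -(scale0r 0) dotpZl mul0r.
  apply: cvg_dotp => //.
  by apply: cvg_ptD => //; apply: cvg_ptN; exact: cvg_pt_cst.
(* Since the steps may have no limit, the inequality is passed to the limit with the constant
   [kappa] in their place. *)
suff : kappa * dotp (field Q zs) (zs - w) <= 0.
  by rewrite pmulr_rle0 // !(dotpDr, dotpNr); lra.
have ktl : kappa * dotp (field Q (z k)) (zpred (z k) - w) @[k --> U] -->
    kappa * dotp (field Q zs) (zs - w).
  by apply: cvgM => //; exact: cvg_cst.
have nsl : `|dotp (z k - zpred (z k)) (zpred (z k) - w)| @[k --> U] --> (0 : R).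
  by rewrite -(normr0 R); exact: cvg_norm.
apply: (ler_cvg_to ktl nsl).
near=> k.
have rk : kappa <= rho (z k).
  by apply: rho_ge; [exact: (z_domain k).2|near: k].
set t := dotp (field Q (z k)) _.
have : rho (z k) * t <= dotp (z k - zpred (z k)) (zpred (z k) - w).
  have := projZ_variational Xbar_ge0 (z k - rho (z k) *: field Q (z k)) wD.
  rewrite -/(predictor _ _ _) /t !(dotpDl, dotpDr, dotpNl, dotpNr, dotpZl); lra.
have := ler_norm (dotp (z k - zpred (z k)) (zpred (z k) - w)).
(* Replacing the step by the smaller [kappa] is valid only for positive [t]; for the other sign the
   absolute value on the right suffices. *)
have [t0|t0] := leP t 0.
  by move=> _ _; apply: le_trans (normr_ge0 _); rewrite pmulr_rle0.
have : kappa * t <= rho (z k) * t by rewrite ler_pM2r.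
lra.
Unshelve. all: by end_near. Qed.

Lemma iterates_cvg ws : saddle_point Q ws ->
  exists zs, saddle_point Q zs /\ cvg_pt \oo z zs.
Proof.
move=> wsS; have [U [UU ooU]] := @ultraFilterLemma nat \oo _.
have [zs zl] : exists zs, cvg_pt U z zs.
  apply: (ultra_bounded_pt (w := ws) (K := dist2 (z 0%N) ws)) => k.
  exact: (dist2_nonincreasing wsS (leq0n k)).
have zsS : saddle_point Q zs by exact: limit_saddle ooU wsS zl.
exists zs; split=> //; apply: cvg_pt_dotp0; apply/cvgr0Pnorm_lt => e e0.
have dl : dist2 (z k) zs @[k --> U] --> (0 : R).
  rewrite -[0](_ : dist2 zs zs = 0); last first.
    by rewrite subrr -(scale0r 0) dotpZl mul0r.
  by apply: cvg_dotp; apply: cvg_ptD => //; apply: cvg_ptN; exact: cvg_pt_cst.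
(* One index at distance less than [e] is enough, because the distance to the saddle point [zs]
   never increases. *)
have [k0 dk0] : exists k0, dist2 (z k0) zs < e.
  by apply: (@filter_ex _ U); exact: cvgr_lt dl _ e0.
exists k0 => // k /= k0k; rewrite ger0_norm ?dotp_ge0 //.
exact: le_lt_trans (dist2_nonincreasing zsS k0k) dk0.
Qed.

End Convergence.

Theorem theorem1 (R : realType) (n1 n2 m1 m2 : nat)
    (Q : qcqp R n1 n2 m1 m2) (eps : nat -> R) (M : R)
    (Qconvex : convex_qcqp Q)
    (Qslater : slater Q)
    (Qoptimal : exists x u, optimal Q x u)
    (eps0_bounds : 0 <= eps 0%N < 1)
    (eps_gt0 : forall s : nat, (1 <= s <= 8)%N -> 0 < eps s)
    (eps_sum : \sum_(1 <= s < 9) eps s <= 1 - eps 0%N)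
    (M_gt0 : 0 < M)
    (z0 : 'cV[R]_n1 * 'cV[R]_n2 * 'cV[R]_m1 * 'cV[R]_m2) :
  exists zs : 'cV[R]_n1 * 'cV[R]_n2 * 'cV[R]_m1 * 'cV[R]_m2,
    saddle_point Q zs /\ (pc2pm Q eps M z0 k @[k --> \oo] --> zs).
Proof.
have Xbar_ge0 j : 0 <= Xbar Q j.
  by case: Qslater => x [u [/(_ j)/andP[x0 xX] _ _]]; exact: le_trans xX.
have eps_sum1 : \sum_(1 <= s < 9) eps s <= 1.
  by apply: le_trans eps_sum _; case/andP: eps0_bounds => e0 _; lra.
have [ws wsS] := saddle_point_exists Qconvex Qslater Qoptimal.
(* The sequence is shifted by one so that all its terms lie in [domain]; the shift is undone by the
   bound [N.+1] at the end. *)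
pose z k := pc2pm Q eps M z0 k.+1.
have [k|k|zs [zsS zl]] :=
    iterates_cvg Qconvex Xbar_ge0 eps_gt0 eps_sum1 M_gt0 (z := z) _ _ wsS.
- exact: next_domain.
- by [].
exists zs; split=> // S /(cvg_pt_cvg zl)[N _ NS].
by exists N.+1 => // -[//|k] Nk; exact: (NS k).
Qed.
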